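(* Given a wedged seed PL sphere $L(J)$ (where $L$ is a seed PL sphere on $[m]$ and $J=(j_1,\dots,j_m)\in\mathbb{Z}_{>0}^m$) and the set $\mathrm{CM}(L)$ of DJ classes over $L$, there exists an algorithm for finding the set $\mathrm{CM}(L(J))$ of DJ classes over $L(J)$ whose complexity only depends on the size of $\mathrm{CM}(L)$, the length $\mathrm{len}(J)$ of $J$, and the Picard number of $L$. Such an algorithm is the ''new puzzle algorithm'' described in the context.
   Context: Characteristic maps. Let $K$ be a pure simplicial complex of dimension $n-1$ on vertex set $V$, $|V|=m$. A (mod 2) characteristic map over $K$ is a map $\lambda:V\to\mathbb{Z}_2^n$ such that whenever $\{i_1,\dots,i_n\}\in K$ is a maximal face, $\lambda(i_1),\dots,\lambda(i_n)$ are linearly independent. $\mathrm{GL}(n,\mathbb{Z}_2)$ acts by left multiplication; the orbits are DJ classes, and $\mathrm{CM}(K)$ is the set of DJ classes. The Picard number is $\mathrm{Pic}(K)=m-n$. Wedges. For a vertex $p$, $\mathrm{wed}_p(K)=(I*\mathrm{Lk}_K(p))\cup(\partial I*(K\setminus\{p\}))$ on $(V\setminus\{p\})\cup\{p_1,p_2\}$, where $I$ is the 1-simplex on $p_1,p_2$, $K\setminus\{p\}=\{\sigma\in K:p\notin\sigma\}$, $\mathrm{Lk}_K(\sigma)=\{\tau\in K:\sigma\cup\tau\in K,\sigma\cap\tau=\emptyset\}$. For $p\ne q$, $\mathrm{wed}_{p,q}(K)=\mathrm{wed}_q(\mathrm{wed}_p(K))$. For $J=(j_1,\dots,j_m)\in\mathbb{Z}_{>0}^m$,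 $K(J)$ is obtained from $K$ by performing $j_v-1$ wedges on each vertex $v\in[m]$, and $\mathrm{len}(J)=\left(\sum_k j_k\right)-m$. A seed is a complex that is not obtained from a lower dimensional complex by a wedge operation. Prediagram and squares. For a characteristic map $\lambda$ and a face $\sigma$, $\mathrm{Proj}_\sigma\lambda$ is the characteristic map over $\mathrm{Lk}_K(\sigma)$ given by $s\mapsto[\lambda(s)]\in\mathbb{Z}_2^n/\langle\lambda(v):v\in\sigma\rangle$. The links of $p_1,p_2$ in $\mathrm{wed}_p(K)$, and of $\{p_i,q_j\}$ in $\mathrm{wed}_{p,q}(K)$, are copies of $K$. Classes $\lambda_1,\lambda_2\in\mathrm{CM}(K)$ are $p$-adjacent if some $\Lambda\in\mathrm{CM}(\mathrm{wed}_p(K))$ has $\mathrm{Proj}_{p_2}\Lambda=\lambda_1$, $\mathrm{Proj}_{p_1}\Lambda=\lambda_2$ (possibly $\lambda_1=\lambda_2$). The prediagram $D'(K)$ is the edge-colored pseudograph with node set $\mathrm{CM}(K)$ and an edge colored $p$ for each $p$-adjacent pair. $D'(K)_p$ is its restriction to edges colored $p$, and $D'(K)_p(\lambda)$ is the connected component of $\lambda$ in $D'(K)_p$ (a complete graph). A $pq$-square with corners $\lambda,\lambda^\alpha,\lambda^\beta,\lambda^\gamma$ ($p$-edges $\lambda\lambda^\alpha$, $\lambda^\beta\lambda^\gamma$; $q$-edges $\lambda\lambda^\beta$, $\lambda^\alpha\lambda^\gamma$) is realizable if some $\Lambda\in\mathrm{CM}(\mathrm{wed}_{p,q}(K))$ has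 $\mathrm{Proj}_{\{p_2,q_2\}}\Lambda=\lambda$, $\mathrm{Proj}_{\{p_1,q_2\}}\Lambda=\lambda^\alpha$, $\mathrm{Proj}_{\{p_2,q_1\}}\Lambda=\lambda^\beta$, $\mathrm{Proj}_{\{p_1,q_1\}}\Lambda=\lambda^\gamma$. Given $\lambda,\lambda^\alpha,\lambda^\beta$, the missing piece of the square is the (unique if it exists) $\lambda^\gamma$ making it realizable. Puzzles. $G(J)$ is the 1-skeleton of $\Delta^{j_1-1}\times\dots\times\Delta^{j_m-1}$; nodes are tuples $(v_1,\dots,v_m)$ with $1\le v_i\le j_i$, and two nodes differing in exactly the $p$-th coordinate are joined by an edge colored $p$. Subsquares of $G(J)$ are the 4-cycles obtained by varying two distinct coordinates between two values each. A realizable puzzle is a map $\pi$ from the nodes of $G(J)$ to $\mathrm{CM}(L)$ sending edges colored $p$ to $p$-adjacent pairs and every subsquare to a realizable square; $\mathcal{RP}(L,J)$ is the set of these. It is known (Choi–Park) that $\mathrm{CM}(L(J))$ is in one-to-one correspondence with $\mathcal{RP}(L,J)$; finding $\mathrm{CM}(L(J))$ means computing $\mathcal{RP}(L,J)$. Order on nodes. The depth of a node is $d(v)=|\{i: v_i\ne1\}|$. Nodes are totally ordered by $\preceq$: first by depth, then lexicographically. $d(J)$ denotes the maximal depth of a node. Cost model. Elementary operations are the addition of two $\mathbb{Z}_2$-vectors and access to an array element, each costing $O(1)$. New puzzle algorithm. Input: $L$, $J$, $\mathrm{CM}(L)$. Output: $\mathcal{RP}(L,J)$. Initialization: compute $D'(L)$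 (linear-algebraically from $\mathrm{CM}(L)$); $\pi\leftarrow$ empty map; $\mathcal{RP}(L,J)\leftarrow\emptyset$; $d\leftarrow0$; $v\leftarrow(1,\dots,1)$. Procedure: (1) If $d>d(J)$, add $\pi$ to $\mathcal{RP}(L,J)$. (2) Else: (a) $\Lambda\leftarrow\mathrm{CM}(L)$. (b) For every node $\nu\prec v$ joined to $v$ by an edge colored $p$: (i) $\Lambda\leftarrow\Lambda\cap D'(L)_p(\pi(\nu))$; (ii) for every node $\mu$ with $\nu\prec\mu\prec v$ joined to $v$ by an edge colored $q$ ($q\ne p$), let $u$ be the node completing the subsquare with corners $u,\mu,\nu,v$ ($p$-edges $u\mu,\nu v$; $q$-edges $u\nu,\mu v$), and replace $\Lambda$ by its intersection with the missing piece (or $\emptyset$ if there is none) of the incomplete square $\pi(u),\pi(\mu),\pi(\nu)$. (c) For every $\lambda\in\Lambda$: set $\pi(v)\leftarrow\lambda$; if $v$ is the biggest node of depth $d$, then $d\leftarrow d+1$, $v\leftarrow$ the smallest node of depth $d+1$, and go to (1); else $v\leftarrow$ the next node of depth $d$ in lexicographic order and go to (1). *)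

(* Defs.v *)
From HB Require Import structures.
From mathcomp Require Import all_boot all_order all_algebra.
From mathcomp Require Import reals.

Set Implicit Arguments.
Unset Strict Implicit.
Unset Printing Implicit Defensive.

Import Order.TTheory GRing.Theory Num.Theory.
Local Open Scope ring_scope.

(** * Simplicial complexes *)

Section Complexes.
Variable V : finType.
Implicit Types (K : {set {set V}}) (s t : {set V}).

(* The vertex set is the whole of [V]: there are no ghost vertices. *)
Definition simplicial_complex K : Prop :=
  [/\ set0 \in K,
      forall v, [set v] \in K &
      forall s t, s \in K -> t \subset s -> t \in K].

Definition facet K s : bool := maxset (fun t => t \in K) s.

(* Pure of dimension [n - 1]. *)
Definition pure K (n : nat) : Prop := forall s, facet K s -> #|s| = n.

Definition link K s : {set {set V}} :=
  [set t in K | (s :|: t \in K) && [disjoint s & t]].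

Definition deletion K (p : V) : {set {set V}} := [set s in K | p \notin s].

Definition join (A B : {set {set V}}) : {set {set V}} :=
  [set s :|: t | s in A, t in B].

End Complexes.

(** * Wedges

  The vertex set (V \ {p}) u {p_1, p_2} of wed_p(K) is encoded as [option V],
  with p_1 = [Some p] and p_2 = [None]. *)

Section Wedge.
Variable V : finType.
Implicit Types (K : {set {set V}}) (p : V).

Definition lift_complex K : {set {set option V}} :=
  [set [set Some v | v in (s : {set V})] | s in K].

Definition wed K p : {set {set option V}} :=
  let I : {set option V} := [set Some p; None] in
  join (powerset I) (lift_complex (link K [set p]))
  :|: join (powerset I :\ I) (lift_complex (deletion K p)).

(* [wedge_copy p true] and [wedge_copy p false] identify the vertices of K with
   those of the links of p_1 and of p_2 respectively. The remaining copy of p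
   plays the role of p. *)
Definition wedge_vertex p (b : bool) : option V := if b then Some p else None.

Definition wedge_copy p (b : bool) (v : V) : option V :=
  if v == p then wedge_vertex p (~~ b) else Some v.

End Wedge.

(* wed_{p,q}(K), for p != q. *)
Definition wed2 (V : finType) (K : {set {set V}}) (p q : V) :=
  wed (wed K p) (Some q).

(* For b = c = true: the face {p_1, q_1} of wed_{p,q}(K) and the identification
   of the vertices of K with those of its link; [false] selects p_2, q_2. *)
Definition wedge2_face (V : finType) (p q : V) (b c : bool) :
    {set option (option V)} :=
  [set Some (wedge_vertex p b); wedge_vertex (Some q) c].

Definition wedge2_copy (V : finType) (p q : V) (b c : bool) (v : V) :
    option (option V) :=
  wedge_copy (Some q) c (wedge_copy p b v).

(* Vertices are relabelled by [f]. The complex [K] below is automatically of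
   lower dimension than [wed K p]. *)
Definition seed (V : finType) (L : {set {set V}}) : Prop :=
  forall (W : finType) (K : {set {set W}}) (p : W) (f : option W -> V),
    simplicial_complex K -> bijective f ->
    [set [set f x | x in (s : {set option W})] | s in wed K p] <> L.

(** * PL spheres *)

Section PL.
Variable R : realType.

(* |K|, in barycentric coordinates. *)
Definition realization (V : finType) (K : {set {set V}}) (x : {ffun V -> R})
    : Prop :=
  [/\ forall v, 0 <= x v, \sum_v x v = 1 & [set v | x v != 0] \in K].

Definition linear_extension (T V : finType) (pos : T -> {ffun V -> R})
    (x : {ffun T -> R}) : {ffun V -> R} :=
  [ffun v => \sum_t x t * pos t v].

(* [K'] is (abstractly) a subdivision of [K]: some map |K'| -> |K|, linear on
   each simplex of [K'], is a bijection (hence a homeomorphism, by compactness)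
   and sends each simplex of [K'] into a simplex of [K]. *)
Definition subdivides (T V : finType) (K' : {set {set T}}) (K : {set {set V}})
    : Prop :=
  exists pos : T -> {ffun V -> R},
    let f := linear_extension pos in
    [/\ forall s, s \in K' -> exists2 t, t \in K &
          forall x, realization K' x -> [set v | x v != 0] \subset s ->
            [set v | f x v != 0] \subset t,
        forall x, realization K' x -> realization K (f x),
        forall x y, realization K' x -> realization K' y -> f x = f y -> x = y &
        forall y, realization K y -> exists2 x, realization K' x & f x = y].

(* The boundary of the [n]-simplex. *)
Definition simplex_boundary (n : nat) : {set {set 'I_n.+1}} :=
  [set s : {set 'I_n.+1} | s \proper [set: 'I_n.+1]].

(* PL sphere of dimension [n - 1]: PL homeomorphic to the boundary of the
   [n]-simplex, i.e. the two have isomorphic subdivisions. *)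
Definition PL_sphere (V : finType) (K : {set {set V}}) (n : nat) : Prop :=
  exists (T : finType) (K' : {set {set T}}),
    [/\ simplicial_complex K', subdivides K' K &
        subdivides K' (simplex_boundary n)].

End PL.

(** * Characteristic maps and DJ classes *)

Notation cmap V n := {ffun V -> 'cV['F_2]_n}.

Section CharacteristicMaps.
Variable V : finType.

Definition char_map n (K : {set {set V}}) (l : cmap V n) : bool :=
  [forall (s | facet K s), free [seq l v | v <- enum s]].

(* The GL(n, Z_2)-orbit. *)
Definition DJ n (l : cmap V n) : {set cmap V n} :=
  [set [ffun v => g *m l v] | g : 'M['F_2]_n in unitmx].

Definition CM n (K : {set {set V}}) : {set {set cmap V n}} :=
  [set DJ l | l : cmap V n & char_map K l].

End CharacteristicMaps.

(* The DJ class of Proj_s l over a complex with vertex set [W], the vertices of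
   which are identified by [i] with vertices of Lk(s): [q] runs through the
   linear isomorphisms of Z_2^N / <l(v) : v in s> with Z_2^n, seen as
   surjections from Z_2^N. *)
Definition Proj (V W : finType) (N n : nat) (l : cmap V N) (s : {set V})
    (i : W -> V) : {set cmap W n} :=
  [set [ffun w => q *m l (i w)] | q : 'M['F_2]_(n, N) &
     (\rank q == n) &&
     [forall x : 'cV['F_2]_N,
        (q *m x == 0) == (x \in <<[seq l v | v <- enum s]>>%VS)]].

Section Prediagram.
Variables (V : finType) (n : nat) (K : {set {set V}}).
Implicit Types c : {set cmap V n}.

(* c1 = Proj_{p_2} and c2 = Proj_{p_1} of one class over wed_p(K). *)
Definition adjacent (p : V) c1 c2 : Prop :=
  exists l : cmap (option V) n.+1,
    [/\ char_map (wed K p) l,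
        Proj n l [set wedge_vertex p false] (wedge_copy p false) = c1 &
        Proj n l [set wedge_vertex p true] (wedge_copy p true) = c2].

(* The square with corners c, ca, cb, cg, with p-edges c -- ca, cb -- cg and
   q-edges c -- cb, ca -- cg. *)
Definition realizable_square (p q : V) c ca cb cg : Prop :=
  exists l : cmap (option (option V)) n.+2,
    let proj b b' := Proj n l (wedge2_face p q b b') (wedge2_copy p q b b') in
    [/\ char_map (wed2 K p q) l, proj false false = c, proj true false = ca,
        proj false true = cb & proj true true = cg].

End Prediagram.

(** * Puzzles *)

(* Nodes of G(J), with coordinates numbered from 0 instead of 1. *)
Notation node J := {dffun forall i, 'I_(J i)}.

Definition len m (J : 'I_m -> nat) : nat := (\sum_i J i - m)%N.

(* v and w differ in exactly the p-th coordinate. *)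
Definition edge m (J : 'I_m -> nat) (p : 'I_m) (v w : node J) : Prop :=
  forall i, (v i == w i) = (i != p).

Definition realizable_puzzle m n (L : {set {set 'I_m}}) (J : 'I_m -> nat)
    (pi : {ffun node J -> {set cmap 'I_m n}}) : Prop :=
  [/\ forall v, pi v \in CM n L,
      forall p v w, edge p v w -> adjacent L p (pi v) (pi w) &
      forall p q u mu nu v, p != q ->
        edge p u mu -> edge p nu v -> edge q u nu -> edge q mu v ->
        realizable_square L p q (pi u) (pi mu) (pi nu) (pi v)].

(** * Cost model

  A computation is a pair (number of elementary operations, result). The
  elementary operations are additions of vectors and accesses to array cells
  (coordinates of vectors and nodes included); a loop over an array pays one
  access per iteration. Control flow, tests on scalars
  and counters are free. *)

Definition M (A : Type) : Type := (nat * A)%type.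
Definition cost A (c : M A) : nat := c.1.
Definition result A (c : M A) : A := c.2.

Definition ret A (a : A) : M A := (0%N, a).
Definition bind A B (c : M A) (k : A -> M B) : M B :=
  let d := k c.2 in ((c.1 + d.1)%N, d.2).
(* one elementary operation with result [a] *)
Definition op A (a : A) : M A := (1%N, a).

Notation "'let!' x := c 'in' k" := (bind c (fun x => k))
  (at level 200, x name, c at level 200, k at level 200, only parsing).

Fixpoint foldM A S (f : S -> A -> M S) (acc : S) (s : seq A) : M S :=
  if s is x :: s' then
    let! y := op x in let! acc' := f acc y in foldM f acc' s'
  else ret acc.

Definition mapM A B (f : A -> M B) (s : seq A) : M (seq B) :=
  foldM (fun acc x => let! y := f x in ret (rcons acc y)) [::] s.

Definition filterM A (f : A -> M bool) (s : seq A) : M (seq A) :=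
  foldM (fun acc x => let! b := f x in ret (if b then rcons acc x else acc))
    [::] s.

Definition allM A (f : A -> M bool) (s : seq A) : M bool :=
  foldM (fun acc x => if acc then f x else ret false) true s.

(* Filling an array indexed by [I]: one write per cell, plus the computation of
   its content. *)
Definition tabulate (I : finType) A (f : I -> M A) : M {ffun I -> A} :=
  ((\sum_i (cost (f i)).+1)%N, [ffun i => result (f i)]).

Definition get A (x0 : A) (s : seq A) (i : nat) : M A := op (nth x0 s i).

(** * Linear algebra over Z_2 *)

Section LinearAlgebra.
Variable k : nat.
Notation vec := 'rV['F_2]_k.
Implicit Types (c : 'I_k) (x r : vec) (s : seq vec).

Definition vadd x r : M vec := op (x + r).
Definition vget x c : M 'F_2 := op (x 0 c).

Definition vbuild (f : 'I_k -> M 'F_2) : M vec :=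
  let! a := tabulate f in ret (\row_c a c).

Definition veq x r : M bool :=
  allM (fun c => let! a := vget x c in let! b := vget r c in ret (a == b))
    (enum 'I_k).

(* The first vector of [s] with a nonzero entry at [c], and the other ones. *)
Fixpoint pick_pivot c s : M (option (vec * seq vec)) :=
  if s is x :: s' then
    let! a := vget x c in
    if a != 0 then ret (Some (x, s'))
    else let! o := pick_pivot c s' in
         ret (if o is Some (r, t) then Some (r, x :: t) else None)
  else ret None.

Definition clear c r x : M vec :=
  let! a := vget x c in if a != 0 then vadd x r else ret x.

(* Gauss-Jordan elimination along the columns [cols]: the reduced rows, each
   with the column of its pivot, and the rows left without pivot. *)
Definition eliminate_column (st : seq ('I_k * vec) * seq vec) c :
    M (seq ('I_k * vec) * seq vec) :=
  let! o := pick_pivot c st.2 in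
  if o is Some (r, t) then
    let! d := mapM (fun cx => let! x := clear c r cx.2 in ret (cx.1, x)) st.1 in
    let! t' := mapM (clear c r) t in
    ret (rcons d (c, r), t')
  else ret st.

Definition eliminate (cols : seq 'I_k) s :
    M (seq ('I_k * vec) * seq vec) :=
  foldM eliminate_column ([::], s) cols.

Definition rref (cols : seq 'I_k) s : M (seq ('I_k * vec)) :=
  let! st := eliminate cols s in ret st.1.

(* Remainder of [x] modulo the span of a reduced family. *)
Definition reduce (E : seq ('I_k * vec)) x : M vec :=
  foldM (fun y cr => clear cr.1 cr.2 y) x E.

(* All columns, with [c] in the last position. *)
Definition cols_last c : seq 'I_k := rcons [seq i <- enum 'I_k | i != c] c.

Definition same_rref (E F : seq ('I_k * vec)) : M bool :=
  if size E == size F then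
    allM (fun ef => if ef.1.1 == ef.2.1 then veq ef.1.2 ef.2.2 else ret false)
      (zip E F)
  else ret false.

Definition same_span s t : M bool :=
  let! E := rref (enum 'I_k) s in
  let! F := rref (enum 'I_k) t in
  same_rref E F.

(* Erasing the [c]-th coordinate. *)
Definition puncture c x : M vec :=
  vbuild (fun i => if i == c then ret 0 else vget x i).

End LinearAlgebra.

(** * The algorithm *)

Section ClassComputations.
Variables m n : nat.
Notation vec := 'rV['F_2]_m.
Implicit Types (p q : 'I_m) (C : seq vec).

(* A basis of the space of linear relations between the vectors l(1), ..., l(m),
   which determines the DJ class of l: eliminate in (l(v) | e_v), along the
   first n columns. *)
Definition relations (l : cmap 'I_m n) : M (seq vec) :=
  let! rows := mapM
    (fun v => vbuild (fun c : 'I_(n + m) =>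
       match split c with
       | inl i => op (l v i 0)
       | inr w => ret (w == v)%:R
       end)) (enum 'I_m) in
  let! st := eliminate [seq lshift m i | i <- enum 'I_n] rows in
  mapM (fun x => vbuild (fun w => vget x (rshift n w))) st.2.

(* Two classes are p-adjacent iff their relations agree off p. *)
Definition adjacent_test p C1 C2 : M bool :=
  let! D1 := mapM (puncture p) C1 in
  let! D2 := mapM (puncture p) C2 in
  same_span D1 D2.

(* D'(L), as an array of adjacency matrices: the entry (a, b, p) tells whether
   the a-th and the b-th classes are p-adjacent. Since the components of D'(L)_p
   are complete graphs, with loops, its a-th row lists D'(L)_p(a). *)
Definition prediagram (rels : seq (seq vec)) :
    M (seq (seq {ffun 'I_m -> bool})) :=
  mapM (fun C1 => mapM (fun C2 =>
    tabulate (fun p => adjacent_test p C1 C2)) rels) rels.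

Definition in_component (D : seq (seq {ffun 'I_m -> bool})) p (a b : nat) :
    M bool :=
  let! row := get [::] D a in
  let! cell := get [ffun=> false] row b in
  op (cell p).

(* A relation r for the class c corresponds to a unique relation ra for ca equal
   to r off p, and to a unique rb for cb equal to r off q; the relations for the
   missing piece are then the r + (r + ra) + (r + rb). *)
Definition missing_relations p q C Ca Cb : M (seq vec) :=
  let! Ea := rref (cols_last p) Ca in
  let! Eb := rref (cols_last q) Cb in
  mapM (fun r =>
    let! ea := reduce Ea r in
    let! eb := reduce Eb r in
    let! s := vadd r ea in
    vadd s eb) C.

(* The position in CM(L) of the missing piece, if there is one. *)
Definition missing_piece (rels : seq (seq vec)) p q (c ca cb : nat) :
    M (option nat) :=
  let! C := get [::] rels c in
  let! Ca := get [::] rels ca in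
  let! Cb := get [::] rels cb in
  let! G := missing_relations p q C Ca Cb in
  foldM (fun found k =>
    let! Ck := get [::] rels k in
    let! b := same_span G Ck in
    ret (if b then Some k else found)) None (iota 0 (size rels)).

End ClassComputations.

Section Nodes.
Variables (m : nat) (J : 'I_m -> nat).
Implicit Types u v w : node J.

Definition nget v i : M nat := op (v i : nat).

Definition depth v : M nat :=
  foldM (fun d i => let! a := nget v i in ret (if a != 0%N then d.+1 else d))
    0%N (enum 'I_m).

(* Strict lexicographic order; [Eq] means that no difference was met so far. *)
Definition lex_compare v w : M comparison :=
  foldM (fun acc i =>
    if acc is Eq then
      let! a := nget v i in let! b := nget w i in
      ret (if (a < b)%N then Lt else if (b < a)%N then Gt else Eq)
    else ret acc) Eq (enum 'I_m).

(* v precedes w: first by depth, then lexicographically. *)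
Definition prec v w : M bool :=
  let! dv := depth v in
  let! dw := depth w in
  if dv == dw then
    let! c := lex_compare v w in ret (if c is Lt then true else false)
  else ret (dv < dw)%N.

(* The color of the edge joining v and w, if there is one. *)
Definition edge_color v w : M (option 'I_m) :=
  let! s := filterM (fun i =>
    let! a := nget v i in let! b := nget w i in ret (a != b)) (enum 'I_m) in
  ret (if s is [:: p] then Some p else None).

(* v, with its q-th coordinate replaced by that of w. *)
Definition replace_coord (q : 'I_m) v w : M (node J) :=
  ((\sum_i (cost (nget (if i == q then w else v) i)).+1)%N,
   [ffun i => if i == q then w i else v i]).

(* The node following v, if any: the next one of the same depth or, failing
   that, the smallest one of the next depth. *)
Definition next_node v : M (option (node J)) :=
  foldM (fun best w =>
    let! b := prec v w in
    if b then
      if best is Some z then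
        let! c := prec w z in ret (if c then Some w else best)
      else ret (Some w)
    else ret best) None (enum {: node J}).

Definition first_node (J_gt0 : forall i, (0 < J i)%N) : node J :=
  [ffun i => Ordinal (J_gt0 i)].

End Nodes.

Section NewPuzzleAlgorithm.
Variables (m n : nat) (J : 'I_m -> nat).

(* A (partial) map from nodes to CM(L), given by positions in the array CM(L);
   the cells of the nodes that are not yet visited are irrelevant. *)
Notation assignment := {ffun node J -> nat}.

Definition pget (pi : assignment) (v : node J) : M nat := op (pi v).
Definition pset (pi : assignment) (v : node J) (k : nat) : M assignment :=
  op [ffun w => if w == v then k else pi w].

Variables (rels : seq (seq 'rV['F_2]_m)) (D : seq (seq {ffun 'I_m -> bool})).

(* Steps (2)(a) and (2)(b); [prev] lists the nodes preceding [v]. *)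
Definition candidates (pi : assignment) (prev : seq (node J)) (v : node J) :
    M (seq nat) :=
  foldM (fun La nu =>
    let! o := edge_color nu v in
    if o is Some p then
      let! b := pget pi nu in
      let! La1 := filterM (in_component D p b) La in
      foldM (fun La' mu =>
        let! o' := edge_color mu v in
        if o' is Some q then
          let! before := prec nu mu in
          if before && (q != p) then
            let! u := replace_coord q nu mu in
            let! c := pget pi u in
            let! a := pget pi mu in
            let! g := missing_piece rels p q c a b in
            filterM (fun k => ret (g == Some k)) La'
          else ret La'
        else ret La') La1 prev
    else ret La) (iota 0 (size rels)) prev.

(* Steps (1) and (2) from the node [ov] on ([None] when all the nodes have been
   visited). The recursion is bounded by [fuel], the number of nodes left. *)
Fixpoint procedure (fuel : nat) (pi : assignment) (prev : seq (node J))
    (ov : option (node J)) : M (seq assignment) :=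
  match ov, fuel with
  | None, _ => op [:: pi]
  | Some _, 0 => ret [::]
  | Some v, fuel'.+1 =>
      let! La := candidates pi prev v in
      foldM (fun out k =>
        let! pi' := pset pi v k in
        let! ov' := next_node v in
        let! out' := procedure fuel' pi' (rcons prev v) ov' in
        ret (out ++ out')) [::] La
  end.

End NewPuzzleAlgorithm.

(* Input: CM(L), as an array of representatives, and J. *)
Definition new_puzzle_algorithm m n (cm : seq (cmap 'I_m n)) (J : 'I_m -> nat)
    (J_gt0 : forall i, (0 < J i)%N) : M (seq {ffun node J -> nat}) :=
  let! rels := mapM (@relations m n) cm in
  let! D := prediagram rels in
  procedure rels D #|{: node J}| [ffun=> 0%N] [::] (Some (first_node J_gt0)).

Definition represents_CM m n (L : {set {set 'I_m}}) (cm : seq (cmap 'I_m n)) :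
    Prop :=
  uniq [seq DJ l | l <- cm] /\ [seq DJ l | l <- cm] =i CM n L.

(* The map from nodes to DJ classes encoded by an assignment of positions. *)
Definition puzzle_of m n (cm : seq (cmap 'I_m n)) (J : 'I_m -> nat)
    (pi : {ffun node J -> nat}) : {ffun node J -> {set cmap 'I_m n}} :=
  [ffun v => nth set0 [seq DJ l | l <- cm] (pi v)].

(* Main.v *)
Require Import Defs.
From HB Require Import structures.
From mathcomp Require Import all_boot all_order all_algebra.
From mathcomp Require Import reals.
From mathcomp Require Import boolp ring lra.

(** A DJ class is determined by its space of relations, the vectors r over Z_2
    for which the sum of the r(v) l(v) is 0 ([DJ_eqP]). Everything that the
    algorithm computes is a statement about these spaces, because the relations
    of a projection are the restrictions of relations ([Proj_relation],
    [ProjP]).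

    Correctness. Restricting the relations of a map over wed_p(L) to the two
    copies of L shows that two classes are p-adjacent iff their relations agree
    off p ([adjacentP]). Likewise a pq-square is realizable iff, from each
    corner, every relation r has companions r + x e_p, r + y e_q and
    r + x e_p + y e_q at the other corners ([realizable_squareP]). In both cases
    the map over the wedge is built by adding to a map over L one new coordinate
    per wedge, which records the entry at p or q of the neighbouring relation.
    The condition on squares is symmetric, and given adjacency it says that the
    fourth space of relations is the one computed by the algorithm
    ([missing_relationsP]); spaces are compared reliably because the reduced
    echelon form is unique ([result_same_span]). By symmetry it is enough to
    test a square when its largest corner is reached ([admissible_puzzle]), and
    the backtracking search lists without repetition the assignments that pass
    all tests ([procedure_all]).

    Complexity. The cost is a function of m, n, J and the array of classes. The
    Picard number bounds m as soon as there is a characteristic map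
    ([seed_bound]); then the number of classes, the length and the Picard number
    leave finitely many inputs, and the largest cost among them is the required
    bound ([cost_bound]). For the bound on m, code a vertex by its values on a
    basis of the relations, so that there are at most 2 ^ (m - n) codes. Every
    facet meets any two vertices with the same code. If three vertices share a code,
    two of them span an edge, and a sphere in which every facet meets a given
    edge is a wedge ([transversal_edge_not_seed]). The last step uses that every
    ridge of a PL sphere lies in at least two facets ([no_free_face]), which is
    read off the tangent cones of the realizations at corresponding points of a
    common subdivision. *)

Set Implicit Arguments.
Unset Strict Implicit.
Unset Printing Implicit Defensive.

Import Order.TTheory GRing.Theory Num.Theory.
Local Open Scope ring_scope.

(** * Results of monadic loops *)

(** Correctness concerns the results of computations only; the lemmas of this part
    turn each loop into the corresponding pure operation on sequences. *)
Lemma result_bind A B (c : M A) (k : A -> M B) :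
  result (bind c k) = result (k (result c)).
Proof. by []. Qed.

Lemma result_ret A (a : A) : result (ret a) = a.
Proof. by []. Qed.

Lemma result_op A (a : A) : result (op a) = a.
Proof. by []. Qed.

Lemma result_if A (b : bool) (c d : M A) :
  result (if b then c else d) = if b then result c else result d.
Proof. by case: b. Qed.

(** Rewriting with [resE] may unfold any computation whose head is a [bind], so
    the lemmas about such computations are rewritten first. *)
Definition resE := (result_bind, result_ret, result_op, result_if).

Arguments result : simpl never.
Arguments bind : simpl never.

Lemma result_foldM A S (f : S -> A -> M S) acc s :
  result (foldM f acc s) = foldl (fun a x => result (f a x)) acc s.
Proof. by elim: s acc => //= x s IHs acc; rewrite !resE IHs. Qed.

Lemma result_mapM A B (f : A -> M B) s :
  result (mapM f s) = [seq result (f x) | x <- s].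
Proof.
rewrite result_foldM -[RHS]cat0s; elim: s [::] => [|x s IHs] acc /=.
  by rewrite cats0.
by rewrite IHs !resE -cats1 -catA.
Qed.

Lemma result_filterM A (f : A -> M bool) s :
  result (filterM f s) = [seq x <- s | result (f x)].
Proof.
rewrite result_foldM -[RHS]cat0s; elim: s [::] => [|x s IHs] acc /=.
  by rewrite cats0.
by rewrite IHs !resE; case: ifP; rewrite // -cats1 -catA.
Qed.

Lemma result_allM A (f : A -> M bool) s :
  result (allM f s) = all (fun x => result (f x)) s.
Proof.
rewrite result_foldM.
have H : forall b, foldl (fun a x => result (if a then f x else ret false)) b s
  = b && all (fun x => result (f x)) s.
  by elim: s => [|x s IHs] b /=; rewrite ?andbT // IHs; case: b.
exact: H.
Qed.

Lemma result_tabulate (I : finType) A (f : I -> M A) :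
  result (tabulate f) = [ffun i => result (f i)].
Proof. by []. Qed.

(** * Gaussian elimination over Z_2 *)

Lemma F2P (x : 'F_2) : x = 0 \/ x = 1.
Proof. by case: x => [[|[|//]]] ?; [left|right]; apply: val_inj. Qed.

Lemma F2_neq0 (x : 'F_2) : x != 0 -> x = 1.
Proof. by case: (F2P x) => ->. Qed.

Lemma F2_addxx (x : 'F_2) : x + x = 0.
Proof. by case: (F2P x) => ->; apply: val_inj. Qed.

Lemma F2_oppr (x : 'F_2) : - x = x.
Proof. by case: (F2P x) => ->; apply: val_inj. Qed.

Lemma F2_double (V : lmodType 'F_2) (x : V) : x + x = 0.
Proof. by rewrite -mulr2n -scaler_nat (_ : 2%:R = 0) ?scale0r //; apply: val_inj. Qed.

Lemma F2_opp (V : lmodType 'F_2) (x : V) : - x = x.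
Proof. by apply: (addIr x); rewrite F2_double addNr. Qed.

Lemma uniq_map_inj (T1 T2 : eqType) (f : T1 -> T2) s :
  uniq [seq f x | x <- s] -> {in s &, injective f}.
Proof.
elim: s => [//|z s IHs] /= /andP[nz us] x y.
rewrite !inE => /predU1P[->|xs] /predU1P[->|ys] // e; last exact: IHs.
  by rewrite e map_f in nz.
by rewrite -e map_f in nz.
Qed.

Lemma span_ind (vT : vectType 'F_2) (P : vT -> Prop) (s : seq vT) :
  P 0 -> (forall a x y, P x -> P y -> P (a *: x + y)) ->
  {in s, forall x, P x} -> {in <<s>>%VS, forall x, P x}.
Proof.
move=> P0 PD Ps x xs; rewrite (coord_span (X := in_tuple s) xs).
elim/big_rec: _ => // i y _ Py; apply: PD => //; apply: Ps.
by rewrite mem_nth.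
Qed.

Section Gauss.
Variable k : nat.
Notation vec := 'rV['F_2]_k.
Implicit Types (c : 'I_k) (x r : vec) (s t : seq vec) (E : seq ('I_k * vec)).

Lemma span_map_linear k' (h : vec -> 'rV['F_2]_k') s :
  (forall a x y, h (a *: x + y) = a *: h x + h y) ->
  forall z, z \in <<[seq h x | x <- s]>>%VS <->
    exists2 x, x \in <<s>>%VS & h x = z.
Proof.
move=> hlin.
have h0 : h 0 = 0.
  by have := hlin 1 0 0; rewrite !scale1r addr0 F2_double.
move=> z; split; last first.
  case=> x xs <-.
  apply: (span_ind (P := fun x => h x \in <<[seq h x | x <- s]>>%VS)) xs.
  - by rewrite h0 mem0v.
  - by move=> a y u hy hu; rewrite hlin memvD ?memvZ.
  - by move=> y ys; rewrite memv_span ?map_f.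
apply: (span_ind (P := fun z => exists2 x, x \in <<s>>%VS & h x = z)).
- by exists 0; rewrite ?mem0v.
- move=> a _ _ [x xs <-] [y ys <-]; exists (a *: x + y); rewrite ?hlin //.
  by rewrite memvD ?memvZ.
- by move=> _ /mapP[x xs ->]; exists x; rewrite ?memv_span.
Qed.

Lemma result_vget x c : result (vget x c) = x 0 c.
Proof. by []. Qed.

Lemma result_vadd x r : result (vadd x r) = x + r.
Proof. by []. Qed.

Lemma result_vbuild (f : 'I_k -> M 'F_2) :
  result (vbuild f) = \row_c result (f c).
Proof.
by rewrite !resE result_tabulate; apply/rowP => c; rewrite !mxE ffunE.
Qed.

Lemma result_veq x r : result (veq x r) = (x == r).
Proof.
rewrite result_allM; apply/allP/eqP => [H|-> c _]; last by rewrite !resE eqxx.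
by apply/rowP => c; apply/eqP; apply: (H c); rewrite mem_enum.
Qed.

Lemma result_clear c r x : result (clear c r x) = x + x 0 c *: r.
Proof.
by rewrite !resE ?result_vget; case: (F2P (x 0 c)) => -> /=;
   rewrite ?result_vadd ?scale1r ?scale0r ?addr0.
Qed.

Lemma pick_pivotP c s :
  match result (pick_pivot c s) with
  | Some (r, t) => r 0 c = 1 /\ perm_eq s (r :: t)
  | None => {in s, forall x, x 0 c = 0}
  end.
Proof.
elim: s => [|x s IHs] //=; rewrite !resE ?result_vget.
case: eqP => [x0|/eqP/F2_neq0 x1] /=; last by rewrite x1.
case: (result _) IHs => [[r t] [r1 prt]|H] /=.
  split=> //; rewrite -[r :: x :: t]/([:: r] ++ [:: x] ++ t) perm_sym perm_catCA.
  by rewrite perm_sym /= perm_cons.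
by move=> y; rewrite inE => /predU1P[->//|/H].
Qed.

(** The columns chosen by the elimination depend on the span [U] of the rows
    only: [c] is chosen when some vector of [U] has its first nonzero entry
    there. The echelon form is canonical because of this. *)
Definition is_pivot (U : {vspace vec}) (before : seq 'I_k) c : Prop :=
  exists2 x, x \in U & x 0 c != 0 /\ {in before, forall d, x 0 d = 0}.

Fixpoint pivots (U : {vspace vec}) (before cols : seq 'I_k) : seq 'I_k :=
  if cols is c :: cols' then
    (if `[< is_pivot U before c >] then [:: c] else [::])
      ++ pivots U (rcons before c) cols'
  else [::].

(** Invariant of the elimination of the columns [cols] from rows that span
    [U]. *)
Record reduced (U : {vspace vec}) (cols : seq 'I_k)
    (st : seq ('I_k * vec) * seq vec) : Prop := Reduced {
  reduced_span : <<[seq e.2 | e <- st.1] ++ st.2>>%VS = U;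
  reduced_rest : forall x c, x \in st.2 -> c \in cols -> x 0 c = 0;
  reduced_pivots : [seq e.1 | e <- st.1] = pivots U [::] cols;
  reduced_rows : forall d e, d \in st.1 -> e \in st.1 ->
     d.2 0 e.1 = (d.1 == e.1)%:R }.

Lemma pivots_rcons U before cols c :
  pivots U before (rcons cols c) = pivots U before cols ++
    (if `[< is_pivot U (before ++ cols) c >] then [:: c] else [::]).
Proof.
elim: cols before => [|d cols IHc] before /=; first by rewrite cats0 cats0.
by rewrite IHc catA cat_rcons.
Qed.

Lemma sub_pivots U before cols : {subset pivots U before cols <= cols}.
Proof.
elim: cols before => //= c cols IHc before d; rewrite mem_cat inE => /orP[].
  by case: ifP => // _; rewrite inE => ->.
by move/IHc ->; rewrite orbT.
Qed.

Lemma uniq_pivots U before cols : uniq cols -> uniq (pivots U before cols).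
Proof.
elim: cols before => //= c cols IHc before /andP[ncols ucols].
rewrite cat_uniq has_sym IHc // andbT; case: ifP => //= _.
by rewrite orbF; apply: contra ncols => /sub_pivots.
Qed.

(** Subtracting from [x] its entries at the pivots times the pivot rows is a
    linear map that kills the pivot rows and fixes the remaining ones; it also
    fixes the vectors that vanish at the pivots. *)
Lemma reduced_ker U cols st x : uniq cols -> reduced U cols st -> x \in U ->
  {in pivots U [::] cols, forall c, x 0 c = 0} -> x \in <<st.2>>%VS.
Proof.
case: st => E t ucols [/= eU t0 pE rE] xU x0.
pose h (y : vec) : vec := y + \sum_(e <- E) y 0 e.1 *: e.2.
have hx : h x = x.
  rewrite /h big1_seq ?addr0 // => e /andP[_ eE].
  by rewrite x0 ?scale0r // -pE map_f.
rewrite -hx; move: xU; rewrite -eU; move: x {x0 hx}.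
have hlin a y z : h (a *: y + z) = a *: h y + h z.
  rewrite /h scalerDr addrACA; congr (_ + _).
  rewrite scaler_sumr -big_split /=; apply: eq_bigr => e _.
  by rewrite !mxE scalerDl scalerA.
apply: span_ind.
- by rewrite /h add0r big1 ?mem0v // => e _; rewrite mxE scale0r.
- by move=> a y z hy hz; rewrite hlin memvD ?memvZ.
move=> y; rewrite mem_cat => /orP[/mapP[e eE ->]|yt].
  have uE : uniq E by apply: (@map_uniq _ _ fst); rewrite pE uniq_pivots.
  rewrite /h (bigD1_seq e) //= rE // eqxx scale1r addrA F2_double add0r.
  rewrite big1_seq ?mem0v // => d /andP[nde dE]; rewrite rE //.
  case: eqP => [ede|]; last by rewrite scale0r.
  have /uniq_map_inj inj : uniq [seq e.1 | e <- E] by rewrite pE uniq_pivots.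
  by rewrite (inj _ _ dE eE (esym ede)) eqxx in nde.
rewrite /h big1_seq ?addr0 ?memv_span // => e /andP[_ eE].
by rewrite t0 ?scale0r // (@sub_pivots U [::]) // -pE map_f.
Qed.

(** This is why the pivot found by [pick_pivot] among the remaining rows agrees
    with the intrinsic notion [is_pivot]. *)
Lemma reduced_pivot_rest U cols st c : uniq cols -> reduced U cols st ->
  is_pivot U cols c <-> exists2 x, x \in st.2 & x 0 c != 0.
Proof.
move=> ucols red; split=> [[x xU [xc x0]]|[x xt xc]]; last first.
  exists x; last by split=> // d /(reduced_rest red xt).
  by rewrite -(reduced_span red) memv_span // mem_cat xt orbT.
have xt : x \in <<st.2>>%VS.
  by apply: (reduced_ker ucols red xU) => // d /sub_pivots; apply: x0.
apply: contrapT => noc.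
suff : x 0 c = 0 by move/eqP; rewrite (negPf xc).
move: x xt {xU xc x0}; apply: span_ind; first by rewrite mxE.
  by move=> a x y; rewrite !mxE => -> ->; rewrite mulr0 addr0.
by move=> x xt; apply/eqP/negPn/negP => xc; apply: noc; exists x.
Qed.

Lemma span_subP s t : {in s, forall x, x \in <<t>>%VS} -> (<<s>> <= <<t>>)%VS.
Proof. by move=> st; apply/span_subvP => x /st. Qed.

Lemma eliminate_columnP U cols st c : uniq (rcons cols c) ->
  reduced U cols st ->
  reduced U (rcons cols c) (result (eliminate_column st c)).
Proof.
move=> ucs red; have := ucs; rewrite rcons_uniq => /andP[ncols ucols].
have pP := reduced_pivot_rest c ucols red.
rewrite /eliminate_column !resE.
case: (result _) (pick_pivotP c st.2) => [[r t]|] /=; last first.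
  move=> t0; have npc : ~ is_pivot U cols c.
    by move/pP => [x /t0 ->]; rewrite eqxx.
  split; [exact: reduced_span red | | | exact: reduced_rows red].
    move=> x d xt; rewrite mem_rcons inE => /predU1P[->|]; first exact: t0.
    exact: (reduced_rest red).
  rewrite (reduced_pivots red) pivots_rcons cat0s asboolF //.
  by rewrite cats0.
move=> [rc prt]; rewrite !resE !result_mapM.
have rt : r \in st.2 by rewrite (perm_mem prt) mem_head.
have tt x : x \in t -> x \in st.2.
  by move=> xt; rewrite (perm_mem prt) inE xt orbT.
have pc : is_pivot U cols c by apply/pP; exists r; rewrite ?rc.
have Ecols e : e \in st.1 -> e.1 \in cols.
  move=> eE; apply: (@sub_pivots U [::]); rewrite -(reduced_pivots red).
  exact: map_f.
have r0 d : d \in cols -> r 0 d = 0 by move=> dc; apply: (reduced_rest red).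
have nEc e : e \in st.1 -> (e.1 == c) = false.
  by move=> /Ecols; apply: contraTF => /eqP ->.
split=> /=.
- rewrite -(reduced_span red); apply/eqP; rewrite eqEsubv; apply/andP; split.
    apply: span_subP => x; rewrite mem_cat map_rcons mem_rcons inE -orbA.
    have rS : r \in <<[seq e.2 | e <- st.1] ++ st.2>>%VS.
      by rewrite memv_span // mem_cat rt orbT.
    case/or3P => [/eqP -> //|/mapP[e /mapP[e' eE ->] ->]|/mapP[y yt ->]].
      rewrite !(result_clear, resE) /= memvD ?memvZ // memv_span //.
      by rewrite mem_cat map_f.
    rewrite result_clear /= memvD ?memvZ // memv_span //.
    by rewrite mem_cat tt // orbT.
  set S := (X in (_ <= X)%VS).
  have rS : r \in S.
    by rewrite memv_span // mem_cat map_rcons mem_rcons mem_head.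
  have addr x : x + x 0 c *: r \in S -> x \in S.
    move=> xS; rewrite -[x]addr0 -(F2_double (x 0 c *: r)) addrA.
    by rewrite memvD ?memvZ.
  apply: span_subP => x; rewrite mem_cat (perm_mem prt) inE.
  case/or3P => [/mapP[e eE ->]|/eqP -> //|xt]; apply: addr; rewrite memv_span //.
    rewrite mem_cat map_rcons mem_rcons inE -map_comp.
    apply/orP; left; apply/orP; right; apply/mapP; exists e => //.
    by rewrite /comp !(result_clear, resE).
  rewrite mem_cat; apply/orP; right; apply/mapP; exists x => //.
  by rewrite result_clear.
- move=> _ d /mapP[x xt ->]; rewrite result_clear !mxE mem_rcons inE.
  case/predU1P => [->|dcols]; first by rewrite rc mulr1 F2_addxx.
  by rewrite r0 // mulr0 addr0 (reduced_rest red (tt _ xt)).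
- rewrite map_rcons pivots_rcons cat0s asboolT // cats1 -(reduced_pivots red).
  by rewrite -map_comp; congr rcons; apply: eq_map => e; rewrite /comp !resE.
- move=> d e; rewrite !mem_rcons !inE.
  case/predU1P => [->|/mapP[d' dE ->]] /predU1P[->|/mapP[e' eE ->]];
    rewrite ?(result_clear, resE) /=.
  + by rewrite rc eqxx.
  + by rewrite r0 ?Ecols // eq_sym nEc.
  + by rewrite !mxE rc mulr1 F2_addxx nEc.
  + rewrite !mxE r0 ?Ecols // mulr0 addr0.
    exact: (reduced_rows red dE eE).
Qed.

Lemma eliminateP cols s : uniq cols ->
  reduced <<s>>%VS cols (result (eliminate cols s)).
Proof.
rewrite /eliminate result_foldM.
elim/last_ind: cols => [|cols c IHc] ucs /=; first by split.
rewrite foldl_rcons; apply: eliminate_columnP => //; apply: IHc.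
by move: ucs; rewrite rcons_uniq => /andP[].
Qed.

Lemma full_reduced_rest U cols st x : reduced U cols st ->
  (forall c, c \in cols) -> x \in <<st.2>>%VS -> x = 0.
Proof.
move=> red allc; move: x; apply: span_ind => //.
  by move=> a x y -> ->; rewrite scaler0 addr0.
move=> x xt; apply/rowP => c; rewrite mxE; exact: (reduced_rest red xt (allc c)).
Qed.

Lemma full_reduced_eq0 U cols st x : uniq cols -> (forall c, c \in cols) ->
  reduced U cols st -> x \in U ->
  {in st.1, forall e, x 0 e.1 = 0} -> x = 0.
Proof.
move=> ucols allc red xU x0; apply: (full_reduced_rest red) => //.
apply: (reduced_ker ucols red xU) => // c; rewrite -(reduced_pivots red).
by case/mapP => e eE ->; apply: x0.
Qed.

(** Uniqueness of the reduced echelon form: the pivots are intrinsic, and two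
    rows with the same pivot differ by a vector of [U] that vanishes at all
    pivots, hence is 0. *)
Lemma reduced_unique U cols st st' : uniq cols -> (forall c, c \in cols) ->
  reduced U cols st -> reduced U cols st' -> st.1 = st'.1.
Proof.
move=> ucols allc red red'.
have pE : [seq e.1 | e <- st.1] = [seq e.1 | e <- st'.1].
  by rewrite (reduced_pivots red) (reduced_pivots red').
have sE : size st.1 = size st'.1 by rewrite -(size_map fst) pE size_map.
case: (posnP (size st.1)) => [/eqP|pos].
  move=> s0; move: (s0); rewrite sE; move: s0.
  by rewrite !size_eq0 => /eqP -> /eqP ->.
have [e0 _] : exists e0, e0 \in st.1.
  by case: (st.1) pos => // e0 ? _; exists e0; rewrite mem_head.
apply: (eq_from_nth (x0 := e0)) => // i ilt.
have nE : forall j, (j < size st.1)%N ->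
    (nth e0 st.1 j).1 = (nth e0 st'.1 j).1.
  move=> j jlt; rewrite -!(nth_map e0 e0.1 fst) -?sE // pE //.
have mE : nth e0 st.1 i \in st.1 by rewrite mem_nth.
have mE' : nth e0 st'.1 i \in st'.1 by rewrite mem_nth -?sE.
rewrite [LHS]surjective_pairing [RHS]surjective_pairing nE //; congr pair.
rewrite -[LHS]addr0 -(F2_double (nth e0 st'.1 i).2) addrA.
rewrite [X in X + _](_ : _ = 0) ?add0r //.
apply: (full_reduced_eq0 ucols allc red) => //.
  apply: memvD; first by rewrite -(reduced_span red) memv_span // mem_cat map_f.
  by rewrite -(reduced_span red') memv_span // mem_cat map_f.
move=> e eE; rewrite mxE (reduced_rows red) //.
have : e.1 \in [seq e.1 | e <- st'.1] by rewrite -pE map_f.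
case/mapP => e' eE' ->; rewrite (reduced_rows red') // nE // F2_addxx //.
Qed.

Lemma result_same_rref E F : result (same_rref E F) = (E == F).
Proof.
rewrite /same_rref result_if; case: eqP => [sE|nE]; last first.
  by apply/esym/eqP => e; rewrite e in nE.
rewrite result_allM.
transitivity (all (fun ef => ef.1 == ef.2) (zip E F)).
  apply: eq_all => -[[a x] [b y]]; rewrite !resE result_veq /=.
  by rewrite -pair_eqE /pair_eq /=; case: eqP.
elim: E F sE => [|e E IHE] [|f F] //= [sE].
by rewrite IHE // eqseq_cons.
Qed.

Lemma result_same_span s t :
  result (same_span s t) = (<<s>>%VS == <<t>>%VS).
Proof.
rewrite /same_span 2!result_bind result_same_rref /rref !result_bind !result_ret.
have u := enum_uniq 'I_k; have a : forall c, c \in enum 'I_k.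
  by move=> c; rewrite mem_enum.
have reds := eliminateP s u; have redt := eliminateP t u.
apply/eqP/eqP => [e|e]; last first.
  by rewrite e in reds; apply: (reduced_unique u a reds redt).
rewrite -(reduced_span reds) -(reduced_span redt) e !span_cat.
by congr (_ + _)%VS; apply/vspaceP => x; apply/idP/idP => xt;
   [rewrite (full_reduced_rest reds a xt)|rewrite (full_reduced_rest redt a xt)];
   rewrite mem0v.
Qed.

Lemma reduceP U cols st x : reduced U cols st -> uniq cols ->
  (result (reduce st.1 x) + x \in U) /\
  {in st.1, forall e, (result (reduce st.1 x)) 0 e.1 = 0}.
Proof.
move=> red ucols; rewrite /reduce result_foldM.
have uE : uniq [seq e.1 | e <- st.1].
  by rewrite (reduced_pivots red) uniq_pivots.
have rU e : e \in st.1 -> e.2 \in U.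
  by move=> eE; rewrite -(reduced_span red) memv_span // mem_cat map_f.
have rows := reduced_rows red.
elim/last_ind: (st.1) => [|E e IHE] in uE rU rows *.
  by rewrite /= F2_double mem0v.
move: uE; rewrite map_rcons rcons_uniq => /andP[ne uE].
have sub d : d \in E -> d \in rcons E e by rewrite mem_rcons inE orbC => ->.
have eE : e \in rcons E e by rewrite mem_rcons mem_head.
case: IHE => // [d /sub/rU //|d d' /sub dE /sub dE'|yU y0]; first exact: rows.
rewrite foldl_rcons result_clear; split.
  by rewrite addrAC memvD // memvZ // rU.
move=> d; rewrite mem_rcons inE => /predU1P[->|dE]; rewrite !mxE.
  by rewrite rows // eqxx mulr1 F2_addxx.
rewrite (y0 d) // add0r (rows e d eE (sub d dE)).
suff -> : (e.1 == d.1) = false by rewrite mulr0.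
by apply/eqP => ed; case/negP: ne; rewrite ed map_f.
Qed.

(** With [c] as last column and e_c outside the span, [c] is not a pivot; so
    r + r', which is a multiple of e_c, vanishes at all pivots and is the
    remainder of [r]. *)
Lemma reduce_off c s r r' :
  delta_mx 0 c \notin <<s>>%VS -> r' \in <<s>>%VS ->
  (forall i, i != c -> r 0 i = r' 0 i) ->
  result (let! E := rref (cols_last c) s in reduce E r) = r + r'.
Proof.
move=> nc r's rr'; rewrite /rref !resE.
have cols_in d : d \in cols_last c.
  by rewrite mem_rcons inE mem_filter mem_enum andbT orbN.
have u : uniq (cols_last c).
  by rewrite rcons_uniq mem_filter eqxx filter_uniq ?enum_uniq.
have red := eliminateP s u.
have [yU y0] := reduceP r red u.
apply/eqP; rewrite -subr_eq0 F2_opp; apply/eqP.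
apply: (full_reduced_eq0 u cols_in red) => //; first by rewrite addrA memvD.
move=> e eE; rewrite mxE y0 // add0r mxE.
have [ec|nec] := eqVneq e.1 c; last by rewrite rr' // F2_addxx.
case/negP: nc.
have : c \in pivots <<s>>%VS [::] (cols_last c).
  by have := map_f fst eE; rewrite (reduced_pivots red) ec.
rewrite pivots_rcons mem_cat => /orP[/sub_pivots|]; first by rewrite mem_filter eqxx.
case: asboolP => // -[x xU [xc x0]] _.
suff -> : delta_mx 0 c = x by [].
apply/rowP => i; rewrite mxE eqxx /=; have [->|ni] := eqVneq i c.
  by rewrite (F2_neq0 xc).
by rewrite x0 // mem_filter ni mem_enum.
Qed.

End Gauss.

(** * Relations *)

Definition is_relation (V : finType) n (l : cmap V n) (r : V -> 'F_2) : bool :=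
  \sum_v r v *: l v == 0.

(** r + a e_p: the move between relations of two p-adjacent classes. *)
Definition toggle (V : eqType) (p : V) (a : 'F_2) (r : V -> 'F_2) : V -> 'F_2 :=
  fun v => r v + (if v == p then a else 0).

Section Toggle.
Variable V : finType.
Implicit Types (p q v : V) (a b : 'F_2) (r : V -> 'F_2).

Lemma toggleK p a : involutive (toggle p a).
Proof.
move=> r; apply/funext => v; rewrite /toggle -addrA.
by case: eqP; rewrite ?F2_addxx ?addr0.
Qed.

Lemma toggleC p q a b r : toggle p a (toggle q b r) = toggle q b (toggle p a r).
Proof. by apply/funext => v; rewrite /toggle addrAC. Qed.

Lemma toggleD p a b r : toggle p a (toggle p b r) = toggle p (a + b) r.
Proof.
apply/funext => v; rewrite /toggle -addrA; congr (_ + _).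
by case: eqP => _; rewrite ?addr0 // addrC.
Qed.

Lemma toggle0 p r : toggle p 0 r = r.
Proof. by apply/funext => v; rewrite /toggle if_same addr0. Qed.

Lemma toggle_off p a r v : v != p -> toggle p a r v = r v.
Proof. by rewrite /toggle => /negPf ->; rewrite addr0. Qed.

Lemma off_toggle p r r' : (forall v, v != p -> r v = r' v) ->
  r' = toggle p (r p + r' p) r.
Proof.
move=> H; apply/funext => v; rewrite /toggle; case: eqVneq => [->|/H ->].
  by rewrite addrA F2_addxx add0r.
by rewrite addr0.
Qed.

Lemma is_relationD n (l : cmap V n) r r' : is_relation l r ->
  is_relation l r' -> is_relation l (fun v => r v + r' v).
Proof.
move=> /eqP H /eqP H'; rewrite /is_relation; apply/eqP.
by under eq_bigr do rewrite scalerDl; rewrite big_split /= H H' addr0.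
Qed.

Lemma is_relation0 n (l : cmap V n) : is_relation l (fun=> 0).
Proof. by apply/eqP; rewrite big1 // => v _; rewrite scale0r. Qed.

Lemma sum_delta n (l : cmap V n) p :
  \sum_v (if v == p then 1 else 0) *: l v = l p.
Proof.
rewrite (bigD1 p) //= eqxx scale1r big1 ?addr0 // => v /negPf ->.
by rewrite scale0r.
Qed.

Lemma is_relation_toggle n (l : cmap V n) p a r : l p != 0 ->
  is_relation l r -> is_relation l (toggle p a r) -> a = 0.
Proof.
move=> lp /eqP H; rewrite /is_relation /toggle.
under eq_bigr do rewrite scalerDl.
rewrite big_split /= H add0r; case: (F2P a) => -> //.
by rewrite sum_delta (negPf lp).
Qed.

Definition slides n p (l l' : cmap V n) : Prop :=
  forall r, is_relation l r -> exists a, is_relation l' (toggle p a r).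

(** What a class over the double wedge gives at one corner of a square: each
    relation of [c] comes with relations of the other three classes, that differ
    from it at [p] and [q] only, by the same amounts on opposite edges. *)
Definition corner n p q (c ca cb cg : cmap V n) : Prop :=
  forall r, is_relation c r -> exists a b,
    [/\ is_relation ca (toggle p a r), is_relation cb (toggle q b r)
      & is_relation cg (toggle q b (toggle p a r))].

(** Requiring [corner] at all four corners makes the notion invariant under the
    symmetries of the square. *)
Definition square n p q (c ca cb cg : cmap V n) : Prop :=
  [/\ corner p q c ca cb cg, corner p q ca c cg cb, corner p q cb cg c ca
    & corner p q cg cb ca c].

Lemma corner_swap n p q (c ca cb cg : cmap V n) :
  corner p q c ca cb cg -> corner q p c cb ca cg.
Proof.
by move=> H r /H [a [b [ha hb hg]]]; exists b, a; split=> //; rewrite toggleC.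
Qed.

Lemma square_swap n p q (c ca cb cg : cmap V n) :
  square p q c ca cb cg -> square q p c cb ca cg.
Proof. by case=> *; split; apply: corner_swap. Qed.

Lemma square_flip n p q (c ca cb cg : cmap V n) :
  square p q c ca cb cg -> square p q ca c cg cb.
Proof. by case. Qed.

End Toggle.

Section Computations.
Variables m n : nat.
Notation vec := 'rV['F_2]_m.
Implicit Types (l c : cmap 'I_m n) (p q : 'I_m) (C : seq vec).

(** The meaning of the array entry computed for the class of [l]. *)
Definition spans_relations C l : Prop :=
  forall x : vec, (x \in <<C>>%VS) = is_relation l (x 0).

Lemma result_relations l :
  exists2 t : seq 'rV_(n + m), result (relations l) = [seq rsubmx x | x <- t] &
  exists E, reduced <<[seq row_mx (l v)^T (delta_mx 0%R v) | v <- enum 'I_m]>>%VS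
    [seq lshift m i | i <- enum 'I_n] (E, t).
Proof.
rewrite /relations result_bind; set rows := result (mapM _ _).
have -> : rows = [seq row_mx (l v)^T (delta_mx 0 v) | v <- enum 'I_m].
  rewrite /rows result_mapM; apply: eq_map => v; rewrite result_vbuild.
  apply/rowP => c; rewrite !mxE; case: split => [i|w]; first by rewrite mxE.
  by rewrite mxE eqxx.
set rows' := [seq row_mx _ _ | _ <- _]; rewrite result_bind.
set cols := [seq lshift m i | i <- enum 'I_n].
have uc : uniq cols by rewrite map_inj_uniq ?enum_uniq //; exact: (@lshift_inj n m).
have := eliminateP rows' uc.
case: (result _) => E t red; exists t; last by exists E.
rewrite result_mapM; apply: eq_map => x; rewrite result_vbuild.
by apply/rowP => w; rewrite !mxE.
Qed.

(** The rows (l(v) | e_v) span the graph of the map that sends r to the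
    combination of the l(v) with coefficients r; the rows that survive the
    elimination of the left block span the part of the graph over 0. *)
Lemma relationsP l : spans_relations (result (relations l)) l.
Proof.
have [t -> [E red]] := result_relations l; move=> x.
set U := <<_>>%VS in red.
set cols := [seq lshift m i | i <- enum 'I_n] in red.
have uc : uniq cols by rewrite map_inj_uniq ?enum_uniq //; exact: (@lshift_inj n m).
have UP y : y \in U -> lsubmx y = \sum_v (rsubmx y) 0 v *: (l v)^T.
  move: y; apply: span_ind.
  - rewrite !linear0 big1 // => v _; by rewrite mxE scale0r.
  - move=> a y z hy hz; rewrite !linearP /= hy hz scaler_sumr -big_split.
    by apply: eq_bigr => v _; rewrite !mxE scalerDl scalerA.
  - move=> _ /mapP[v _ ->]; rewrite row_mxKl row_mxKr (bigD1 v) //= mxE !eqxx.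
    rewrite scale1r big1 ?addr0 // => w nw.
    by rewrite mxE (negPf nw) andbF scale0r.
have tU y : y \in <<t>>%VS -> y \in U.
  by move=> yt; rewrite -(reduced_span red) span_cat; apply: subvP (addvSr _ _) _ yt.
have t0 y : y \in <<t>>%VS -> lsubmx y = 0.
  move: y; apply: span_ind; first by rewrite linear0.
    by move=> a y z hy hz; rewrite linearP /= hy hz scaler0 addr0.
  move=> y yt; apply/rowP => i; rewrite !mxE; apply: (reduced_rest red) => //.
  by rewrite map_f ?mem_enum.
have hlin a (y z : 'rV['F_2]_(n + m)) :
  rsubmx (a *: y + z) = a *: rsubmx y + rsubmx z by rewrite linearP.
apply/idP/idP.
  move/(span_map_linear t hlin) => [y yt <-].
  have := UP _ (tU _ yt); rewrite t0 // => e; apply/eqP.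
  apply: trmx_inj; rewrite linear_sum trmx0 [RHS]e.
  by apply: eq_bigr => v _; rewrite linearZ.
move=> /eqP H; apply/(span_map_linear t hlin).
pose y : 'rV['F_2]_(n + m) :=
  \sum_v x 0 v *: row_mx (l v)^T (delta_mx 0 v).
have yU : y \in U.
  apply: memv_suml => v _; apply/memvZ/memv_span/map_f.
  by rewrite mem_enum.
have rx : rsubmx y = x.
  rewrite /y linear_sum [RHS]row_sum_delta; apply: eq_bigr => v _ /=.
  by rewrite linearZ /= row_mxKr.
exists y => //; apply: (reduced_ker uc red) => // c /sub_pivots/mapP[i _ ->].
have := UP _ yU; rewrite rx => /(congr1 (fun z : 'rV_n => z 0 i)).
rewrite mxE => ->.
have -> : \sum_v x 0 v *: (l v)^T = (\sum_v x 0 v *: l v)^T.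
  by rewrite linear_sum; apply: eq_bigr => v _; rewrite linearZ.
by rewrite H trmx0 mxE.
Qed.

Definition row_of (r : 'I_m -> 'F_2) : vec := \row_i r i.

Lemma row_ofE r : row_of r 0 = r :> ('I_m -> 'F_2).
Proof. by apply/funext => i; rewrite mxE. Qed.

Lemma result_puncture p (x : vec) :
  result (puncture p x) = \row_i (if i == p then 0 else x 0 i).
Proof.
by rewrite result_vbuild; apply/rowP => i; rewrite !mxE; case: eqP.
Qed.

Lemma adjacent_testP p C1 C2 l1 l2 :
  spans_relations C1 l1 -> spans_relations C2 l2 ->
  result (adjacent_test p C1 C2) <-> slides p l1 l2 /\ slides p l2 l1.
Proof.
move=> s1 s2; rewrite /adjacent_test 2!result_bind result_same_span !result_mapM.
pose h (x : vec) : vec := \row_i (if i == p then 0 else x 0 i).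
rewrite !(eq_map (result_puncture p)).
have hlin a (x y : vec) : h (a *: x + y) = a *: h x + h y.
  apply/rowP => i; rewrite !mxE; case: eqP => // _.
  by rewrite mulr0 addr0.
have sub C C' l l' : spans_relations C l -> spans_relations C' l' ->
    ((<<map h C>> <= <<map h C'>>)%VS <-> slides p l l').
  move=> s s'; split.
    move/subvP => H r rl.
    have : h (row_of r) \in <<map h C>>%VS.
      by apply/(span_map_linear C hlin); exists (row_of r); rewrite // s row_ofE.
    move/H/(span_map_linear C' hlin) => [x]; rewrite s' => xl' hx.
    exists (r p + x 0 p); rewrite -off_toggle // => i ni.
    by have := congr1 (fun z : vec => z 0 i) hx; rewrite !mxE (negPf ni).
  move=> H; apply/subvP => _ /(span_map_linear C hlin) [x xC <-].
  apply/(span_map_linear C' hlin); move: xC; rewrite s => /H[a ha].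
  exists (row_of (toggle p a (x 0))); first by rewrite s' row_ofE.
  by apply/rowP => i; rewrite !mxE /toggle; case: eqP => // _; rewrite addr0.
rewrite eqEsubv; split.
  by case/andP => /(sub _ _ _ _ s1 s2) ? /(sub _ _ _ _ s2 s1).
by case=> /(sub _ _ _ _ s1 s2) -> /(sub _ _ _ _ s2 s1) ->.
Qed.

Lemma reduce_linear k (E : seq ('I_k * 'rV['F_2]_k)) a x y :
  result (reduce E (a *: x + y)) =
  a *: result (reduce E x) + result (reduce E y).
Proof.
rewrite /reduce !result_foldM; elim: E x y => //= e E IHE x y.
rewrite !result_clear -IHE; congr foldl.
rewrite !mxE scalerDl scalerDr scalerA addrACA //.
Qed.

Lemma reduce_slide p C l (r : vec) a : spans_relations C l -> l p != 0 ->
  is_relation l (toggle p a (r 0)) ->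
  result (let! E := rref (cols_last p) C in reduce E r) =
    r + row_of (toggle p a (r 0)).
Proof.
move=> s lp hb; apply: reduce_off.
- rewrite s /is_relation (eq_bigr (fun v => (if v == p then 1 else 0) *: l v)).
    by rewrite sum_delta.
  by move=> v _; rewrite mxE eqxx /=; case: eqP.
- by rewrite s row_ofE.
- by move=> i ni; rewrite mxE toggle_off.
Qed.

(** Adding to [r] the remainders modulo the two adjacent classes is linear in
    [r], and sends r to r + a e_p + b e_q. So the vectors computed by the
    algorithm span the space of all companions of relations of [c] at the
    opposite corner, and equality of this space with the relations of [cg] is
    [corner] at [c] and at [cg]; the other two corners follow by adjacency. *)
Lemma missing_relationsP p q C Ca Cb Cg c ca cb cg :
  spans_relations C c -> spans_relations Ca ca -> spans_relations Cb cb ->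
  spans_relations Cg cg -> ca p != 0 -> cb q != 0 ->
  slides p c ca -> slides p ca c -> slides q c cb -> slides q cb c ->
  result (let! G := missing_relations p q C Ca Cb in same_span G Cg) <->
  square p q c ca cb cg.
Proof.
move=> s sa sb sg ap bq Hca Hac Hcb Hbc.
rewrite result_bind result_same_span /missing_relations 2!result_bind result_mapM.
pose h (r : vec) : vec :=
  (r + result (let! E := rref (cols_last p) Ca in reduce E r))
    + result (let! E := rref (cols_last q) Cb in reduce E r).
rewrite (eq_map (g := h)) //.
have hlin a x y : h (a *: x + y) = a *: h x + h y.
  rewrite /h !(result_bind (rref _ _)) !reduce_linear !scalerDr.
  by rewrite [a *: x + y + _]addrACA [LHS]addrACA.
have hE (r : vec) a b : is_relation ca (toggle p a (r 0)) ->
    is_relation cb (toggle q b (r 0)) ->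
    h r = row_of (toggle q b (toggle p a (r 0))).
  move=> ha hb; rewrite /h (reduce_slide sa ap ha) (reduce_slide sb bq hb).
  rewrite (addrA r r) F2_double add0r; apply/rowP => i; rewrite !mxE /toggle.
  by rewrite (addrA (r 0 i) (r 0 i)) F2_addxx add0r.
rewrite eqEsubv; split.
  case/andP => /subvP GR /subvP RG.
  have key r a b : is_relation c r -> is_relation ca (toggle p a r) ->
      is_relation cb (toggle q b r) -> is_relation cg (toggle q b (toggle p a r)).
    move=> rc ha hb; have : h (row_of r) \in <<[seq h i | i <- C]>>%VS.
      by apply/(span_map_linear C hlin); exists (row_of r); rewrite // s row_ofE.
    by move/GR; rewrite (@hE _ a b) ?row_ofE // sg row_ofE.
  split=> r hr.
  - have [a ha] := Hca r hr; have [b hb] := Hcb r hr.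
    by exists a, b; split=> //; apply: key.
  - have [a ha] := Hac r hr; have [b hb] := Hcb _ ha.
    exists a, b; split=> //.
    by have := key _ a b ha; rewrite toggleK; apply.
  - have [b hb] := Hbc r hr; have [a ha] := Hca _ hb.
    exists a, b; split=> //; last by rewrite toggleC.
    have := key _ a b hb ha; rewrite toggleK => /(_ hr).
    by rewrite [toggle p a (toggle q b _)]toggleC toggleK.
  - have := RG (row_of r); rewrite sg row_ofE => /(_ hr).
    move/(span_map_linear C hlin) => [x]; rewrite s => xc.
    have [a ha] := Hca _ xc; have [b hb] := Hcb _ xc.
    rewrite (hE _ _ _ ha hb) => /(congr1 (fun z : vec => z 0 : 'I_m -> 'F_2)).
    rewrite !row_ofE => <-; exists a, b; split.
    + by rewrite toggleC toggleK.
    + by rewrite toggleK.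
    + by rewrite [toggle p a (toggle q b _)]toggleC !toggleK.
case=> K1 K2 K3 K4; apply/andP; split; apply/subvP => x.
  move/(span_map_linear C hlin) => [y yC <-]; move: yC; rewrite s => /K1[a [b [ha hb hg]]].
  by rewrite (hE _ _ _ ha hb) sg row_ofE.
rewrite sg => /K4[a [b [hb ha hc]]]; apply/(span_map_linear C hlin).
exists (row_of (toggle q b (toggle p a (x 0)))); first by rewrite s row_ofE.
rewrite (@hE _ a b) ?row_ofE; first 1 last.
- by rewrite toggleC toggleK.
- by rewrite toggleK.
by apply/rowP => i; rewrite mxE [toggle p a (toggle q b _)]toggleC !toggleK.
Qed.

End Computations.

(** * Characteristic maps, classes and projections *)

Lemma mulmx_col (F : fieldType) a b c (A : 'M[F]_(a, b)) (B : 'M_(b, c)) j :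
  A *m col j B = col j (A *m B).
Proof. by rewrite !colE mulmxA. Qed.

Section Independence.
Variables (V : finType) (n : nat).
Implicit Types (l : cmap V n) (r : V -> 'F_2) (s : {set V}) (K : {set {set V}}).

Definition supp r : {set V} := [set v | r v != 0].

Lemma notin_supp r v : v \notin supp r -> r v = 0.
Proof. by rewrite inE negbK => /eqP. Qed.

Lemma span_mapP l (e : seq V) x : uniq e ->
  x \in <<[seq l v | v <- e]>>%VS <-> exists r, x = \sum_(v <- e) r v *: l v.
Proof.
move=> ue; split; last first.
  case=> r ->; rewrite big_seq; apply: memv_suml => v ve.
  by apply/memvZ/memv_span/map_f.
move: x; apply: span_ind.
- by exists (fun=> 0); rewrite big1 // => v _; rewrite scale0r.
- move=> a _ _ [r ->] [r' ->]; exists (fun v => a * r v + r' v).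
  rewrite scaler_sumr -big_split; apply: eq_bigr => v _ /=.
  by rewrite scalerDl scalerA.
- move=> _ /mapP[v ve ->]; exists (fun w => (w == v)%:R).
  rewrite (bigD1_seq v) //= eqxx scale1r big1 ?addr0 // => w /negPf ->.
  by rewrite scale0r.
Qed.

Lemma free_mapP l (e : seq V) : uniq e ->
  free [seq l v | v <- e] <->
  (forall r, \sum_(v <- e) r v *: l v = 0 -> {in e, forall v, r v = 0}).
Proof.
elim: e => [|v e IHe]; first by rewrite nil_free.
rewrite /= free_cons => /andP[ve ue]; have {}IHe := IHe ue; split.
  case/andP => nl /IHe H r; rewrite big_cons => r0.
  have rv : r v = 0.
    apply/eqP/negPn/negP => /F2_neq0 rv; case/negP: nl.
    apply/(span_mapP l _ ue); exists r; move: r0; rewrite rv scale1r.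
    by move/eqP; rewrite addr_eq0 F2_opp => /eqP.
  move=> w; rewrite inE => /predU1P[->//|]; apply: H.
  by move: r0; rewrite rv scale0r add0r.
move=> H; apply/andP; split.
  apply/negP => /(span_mapP l _ ue)[r lv].
  have e0 : \sum_(w <- v :: e) (if w == v then 1 else r w) *: l w = 0.
    rewrite big_cons eqxx scale1r {1}lv [X in _ + X](_ : _ = \sum_(v <- e) r v *: l v).
      by rewrite F2_double.
    apply: eq_big_seq => w we; case: eqP => // wv; by rewrite -wv we in ve.
  by have := H _ e0 v (mem_head _ _); rewrite eqxx => /eqP.
apply/IHe => r r0 w we.
have e0 : \sum_(w <- v :: e) (if w == v then 0 else r w) *: l w = 0.
  rewrite big_cons eqxx scale0r add0r -[RHS]r0.
  apply: eq_big_seq => u ue'; case: eqP => // uv; by rewrite -uv ue' in ve.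
have := H _ e0 w; rewrite inE we orbT => /(_ isT).
by case: eqP => // wv; rewrite -wv we in ve.
Qed.

Lemma is_relation_restrict l s r : supp r \subset s ->
  \sum_v r v *: l v = \sum_(v in s) r v *: l v.
Proof.
move=> /subsetP sr; rewrite [LHS](bigID (mem s)) /= [X in _ + X]big1 ?addr0 //.
by move=> v vs; rewrite notin_supp ?scale0r //; apply: contra vs => /sr.
Qed.

Lemma free_enumP l s : free [seq l v | v <- enum s] <->
  (forall r, supp r \subset s -> is_relation l r -> r =1 fun=> 0).
Proof.
rewrite (free_mapP l (enum_uniq _)); split=> H r.
  move=> rs; rewrite /is_relation (is_relation_restrict l rs) -big_enum => /eqP.
  move/H => r0 v; case: (boolP (v \in s)) => vs; first by rewrite r0 ?mem_enum.
  by apply: notin_supp; apply: contra vs => /(subsetP rs).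
rewrite big_enum /= => r0 v; rewrite mem_enum => vs.
have sub : supp (fun v => if v \in s then r v else 0) \subset s.
  by apply/subsetP => w; rewrite inE; case: ifP; rewrite ?eqxx.
have := H _ sub; rewrite /is_relation (is_relation_restrict l sub).
under eq_bigr => w ws do rewrite ws.
by rewrite r0 eqxx => /(_ isT v); rewrite vs.
Qed.

(** A relation supported on a face is supported on a facet, where the values of
    the map are independent. *)
Lemma char_mapP K l : simplicial_complex K ->
  char_map K l <->
  (forall r, supp r \in K -> is_relation l r -> r =1 fun=> 0).
Proof.
case=> K0 K1 Kdown; split.
  move=> /forall_inP H r rK.
  have [F /H fF sF] := maxset_exists rK.
  by move/free_enumP: fF; apply.
move=> H; apply/forall_inP => F /maxsetp FK; apply/free_enumP => r rF.
by apply: H; apply: Kdown FK rF.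
Qed.

Lemma char_map_neq0 K l v : simplicial_complex K -> char_map K l -> l v != 0.
Proof.
move=> sK /(char_mapP _ sK) H; apply/eqP => lv.
have := H (fun w => (w == v)%:R).
rewrite (_ : supp _ = [set v]); last first.
  by apply/setP => w; rewrite !inE; case: (w == v).
case: (sK) => _ -> _ /(_ isT).
rewrite /is_relation (bigD1 v) //= lv scaler0 add0r big1.
  by rewrite eqxx => /(_ isT v); rewrite eqxx => /eqP.
by move=> w /negPf ->; rewrite scale0r.
Qed.

Lemma mem_DJ l : l \in DJ l.
Proof.
apply/imsetP; exists 1%:M; first by rewrite unitmx1.
by apply/ffunP => v; rewrite ffunE mul1mx.
Qed.

Lemma mulmx_relation k (g : 'M['F_2]_(k, n)) (f : V -> 'cV_n) r :
  \sum_v r v *: (g *m f v) = g *m \sum_v r v *: f v.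
Proof. by rewrite mulmx_sumr; apply: eq_bigr => v _; rewrite scalemxAr. Qed.

(** Two matrices with the same right kernel have the same row space, hence differ
    by an invertible factor on the left. *)
Lemma DJ_eqP l l' : DJ l = DJ l' <-> is_relation l =1 is_relation l'.
Proof.
split=> [e r|H].
  have : l \in DJ l' by rewrite -e mem_DJ.
  case/imsetP => g ug ->; rewrite /is_relation.
  under eq_bigr do rewrite ffunE.
  rewrite mulmx_relation; apply/eqP/eqP => [|->]; last by rewrite mulmx0.
  by move/(congr1 (mulmx (invmx g))); rewrite mulKmx // mulmx0.
suff [g ug ll'] : exists2 g, g \in unitmx & forall v, l v = g *m l' v.
  apply/setP => x; apply/imsetP/imsetP => -[h uh ->].
    exists (h *m g); first by rewrite unitmx_mul; apply/andP.
    by apply/ffunP => v; rewrite !ffunE ll' mulmxA.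
  exists (h *m invmx g); first by rewrite unitmx_mul unitmx_inv; apply/andP.
  by apply/ffunP => v; rewrite !ffunE ll' mulmxA mulmxKV.
pose mx (k : cmap V n) := \matrix_(i < n, j < #|V|) k (enum_val j) i 0.
have mxr k (x : 'cV_#|V|) : mx k *m x = \sum_v x (enum_rank v) 0 *: k v.
  apply/colP => i; rewrite summxE mxE (reindex enum_rank) /=; last first.
    by apply: onW_bij; apply: enum_rank_bij.
  by apply: eq_bigr => v _; rewrite !mxE enum_rankK mulrC.
have sub k k' : is_relation k =1 is_relation k' -> (mx k <= mx k')%MS.
  move=> kk'; rewrite submxE; apply/eqP/matrixP => i j; rewrite [RHS]mxE.
  have : mx k' *m col j (cokermx (mx k')) = 0.
    by rewrite mulmx_col mulmx_coker; apply/colP => a; rewrite !mxE.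
  rewrite mxr => /eqP.
  rewrite -[_ == 0]/(is_relation k' (fun v => col j (cokermx (mx k')) (enum_rank v) 0)).
  rewrite -kk' /is_relation -mxr mulmx_col => /eqP/colP/(_ i).
  by rewrite !mxE.
have : (mx l == mx l')%MS by rewrite !sub // => r; rewrite H.
case/eqmxMunitP => g ug e; exists g => // v; apply/colP => i.
have := congr1 (fun A : 'M_(n, #|V|) => A i (enum_rank v)) e.
rewrite !mxE enum_rankK => ->; apply: eq_bigr => j _.
by rewrite mxE enum_rankK.
Qed.

End Independence.

Section Projection.
Variables (V W : finType) (N n : nat).
Implicit Types (l : cmap V N) (k : cmap W n) (s : {set V}) (i : W -> V).

Lemma rank_proj (B : 'M['F_2]_N) : \rank B = n ->
  exists2 q : 'M['F_2]_(n, N), \rank q = n &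
    forall x : 'cV_N, (q *m x == 0) = (B *m x == 0).
Proof.
case: n /; exists (row_base B); first by rewrite eq_row_base.
move=> x; have /eqmxP/andP[/submxP[A e1] /submxP[A' e2]] := eq_row_base B.
apply/eqP/eqP => [H|H].
  by rewrite e2 -mulmxA H mulmx0.
by rewrite e1 -mulmxA H mulmx0.
Qed.

(** [i] identifies [W] with the vertices outside [s]. *)
Definition complementary s i : Prop :=
  [/\ injective i, forall w, i w \notin s &
      forall v, v \notin s -> exists w, v = i w].

Lemma complementary_sum l s i r r' : complementary s i ->
  (forall w, r w = r' (i w)) ->
  \sum_v r' v *: l v =
    \sum_(v in s) r' v *: l v + \sum_w r w *: l (i w).
Proof.
case=> inj_i nis onto H; rewrite (bigID (mem s)) /=; congr (_ + _).
rewrite (eq_bigl (mem (i @: [set: W]))) /=.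
  rewrite big_imset /=; last by move=> ? ? _ _; apply: inj_i.
  by apply: eq_big => [w|w _]; rewrite ?inE ?H.
move=> v; apply/idP/imsetP => [/onto[w ->]|[w _ ->]]; last exact: nis.
by exists w.
Qed.

(** The coefficients of a combination of the l(v), v in s, extend r to a relation
    of l. *)
Lemma complementary_span l s i r : complementary s i ->
  \sum_w r w *: l (i w) \in <<[seq l v | v <- enum s]>>%VS <->
  exists2 t, is_relation l t & forall w, r w = t (i w).
Proof.
move=> cs; rewrite (span_mapP l _ (enum_uniq _)); split.
  case=> u; rewrite big_enum => e.
  pose t v := if [pick w | v == i w] is Some w then r w else u v.
  have ti w : t (i w) = r w.
    rewrite /t; case: pickP => [w' /eqP|/(_ w)]; last by rewrite eqxx.
    by case: cs => inj_i _ _ /inj_i ->.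
  exists t => //; rewrite /is_relation.
  rewrite (complementary_sum l cs (r := r)) // e.
  rewrite [X in X + _](eq_bigr (fun v => u v *: l v)) ?F2_double //.
  move=> v vs; rewrite /t; case: pickP => // w /eqP vw.
  by case: cs => _ /(_ w); rewrite -vw vs.
case=> t /eqP t0 rt; exists t; rewrite big_enum /=.
move: t0; rewrite (complementary_sum l cs rt) => /eqP.
by rewrite addr_eq0 F2_opp => /eqP.
Qed.

(** A representative of the projection is [l] followed by a quotient by the span of
    its values on [s], so [complementary_span] applies. *)
Lemma Proj_relation l s i k : complementary s i -> Proj n l s i = DJ k ->
  forall r, is_relation k r <->
    exists2 t, is_relation l t & forall w, r w = t (i w).
Proof.
move=> cs e r; rewrite -(complementary_span l r cs).
have : k \in Proj n l s i by rewrite e mem_DJ.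
case/imsetP => q; rewrite inE => /andP[_ /forallP kerq] ->.
rewrite -(eqP (kerq _)) /is_relation -mulmx_relation.
by under eq_bigr do rewrite ffunE.
Qed.

(** Converse of [Proj_relation]. The third hypothesis says that the values of
    [l] on [s] are independent, so that the quotient by their span has dimension
    [n]; it is cut out by the cokernel of the matrix of these values. *)
Lemma ProjP l s i k : complementary s i -> N = (n + #|s|)%N ->
  (forall t, is_relation l t -> (forall w, t (i w) = 0) -> t =1 fun=> 0) ->
  (forall r, is_relation k r <->
    exists2 t, is_relation l t & forall w, r w = t (i w)) ->
  Proj n l s i = DJ k.
Proof.
move=> cs Nn inj_l H.
pose A := \matrix_(j < #|s|) (l (enum_val j))^T.
have sumA (y : 'rV_#|s|) : y *m A = (\sum_j y 0 j *: l (enum_val j))^T.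
  rewrite mulmx_sum_row linear_sum; apply: eq_bigr => j _ /=.
  by rewrite rowK linearZ.
have enumA (u : V -> 'F_2) : \sum_(v in s) u v *: l v =
    \sum_(j < #|s|) u (enum_val j) *: l (enum_val j).
  by rewrite [LHS]big_enum_val.
have memA (x : 'cV_N) : (x \in <<[seq l v | v <- enum s]>>%VS) = (x^T <= A)%MS.
  apply/idP/idP.
    case/(span_mapP l _ (enum_uniq _)) => u; rewrite big_enum /= enumA => ->.
    apply/submxP; exists (\row_j u (enum_val j)); rewrite sumA.
    by congr (_^T); apply: eq_bigr => j _; rewrite mxE.
  case/submxP => y; rewrite sumA => /trmx_inj ->.
  apply: memv_suml => j _; apply/memvZ/memv_span/map_f.
  by rewrite mem_enum enum_valP.
have fA : row_free A.
  apply: inj_row_free => y; rewrite sumA => /eqP; rewrite trmx_eq0 => /eqP y0.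
  pose u v := if v \in s then \sum_(j | enum_val j == v) y 0 j else 0.
  have uE j : u (enum_val j) = y 0 j.
    rewrite /u enum_valP (bigD1 j) ?eqxx //= big1 ?addr0 // => j'.
    by case/andP => /eqP/enum_val_inj ->; rewrite eqxx.
  have ru : is_relation l u.
    apply/eqP; rewrite (is_relation_restrict l (s := s)); last first.
      by apply/subsetP => v; rewrite inE /u; case: ifP; rewrite ?eqxx.
    by rewrite enumA -[RHS]y0; apply: eq_bigr => j _; rewrite uE.
  have u0 := inj_l u ru; apply/rowP => j; rewrite mxE -uE u0 // => w.
  by rewrite /u; case: cs => _ /(_ w) /negPf ->.
have rA : \rank (cokermx A)^T = n.
  by rewrite mxrank_tr mxrank_coker (eqP fA) Nn addnK.
have [q rq kerq] := rank_proj rA.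
have kq (x : 'cV_N) : (q *m x == 0) = (x \in <<[seq l v | v <- enum s]>>%VS).
  by rewrite memA kerq submxE -trmx_eq0 trmx_mul trmxK.
have -> : DJ k = DJ [ffun w => q *m l (i w)].
  apply/DJ_eqP => r; apply/idP/idP.
    move/H/(complementary_span l r cs); rewrite -kq -mulmx_relation /is_relation.
    by under [X in _ -> X == 0]eq_bigr do rewrite ffunE.
  rewrite /is_relation; under eq_bigr do rewrite ffunE.
  by rewrite mulmx_relation kq => /(complementary_span l r cs)/H.
apply/setP => x; apply/imsetP/imsetP => -[h].
  rewrite inE => /andP[/eqP rh /forallP kerh] ->.
  have /eqmxMunitP[g ug hq] : (h == q)%MS.
    have sub (a b : 'M['F_2]_(n, N)) : (forall x : 'cV_N, b *m x = 0 -> a *m x = 0) ->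
        (a <= b)%MS.
      move=> ab; rewrite submxE; apply/eqP/matrixP => u v; rewrite [RHS]mxE.
      have : b *m col v (cokermx b) = 0.
        by rewrite mulmx_col mulmx_coker; apply/colP => c; rewrite !mxE.
      by move/ab; rewrite mulmx_col => /colP/(_ u); rewrite !mxE.
    apply/andP; split; apply: sub => y.
      by move/eqP; rewrite kq -(eqP (kerh y)) => /eqP.
    by move/eqP; rewrite (eqP (kerh y)) -kq => /eqP.
  by exists g => //; apply/ffunP => w; rewrite !ffunE hq mulmxA.
move=> uh ->; exists (h *m q); last first.
  by apply/ffunP => w; rewrite !ffunE mulmxA.
rewrite inE; apply/andP; split.
  have fq : row_free q by rewrite /row_free rq.
  by rewrite mxrankMfree // mxrank_unit.
apply/forallP => y; rewrite -kq -mulmxA; apply/eqP.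
apply/eqP/eqP => [|->]; last by rewrite mulmx0.
by move/(congr1 (mulmx (invmx h))); rewrite mulKmx // mulmx0.
Qed.

End Projection.

(** * Wedges *)

Lemma mem_imset_Some (V : finType) (A : {set V}) v :
  (Some v \in [set Some w | w in A]) = (v \in A).
Proof. by rewrite mem_imset //; apply: Some_inj. Qed.

Lemma None_notin_imset (V : finType) (A : {set V}) :
  (None \in [set Some w | w in A]) = false.
Proof. by apply/imsetP => -[]. Qed.

Section WedgeFaces.
Variables (V : finType) (K : {set {set V}}) (p : V).
Hypothesis sK : simplicial_complex K.
Implicit Types (s : {set option V}) (t : {set V}).

Definition base s : {set V} := [set v | Some v \in s].

(** A face of the wedge consists of some copies of [p] and of a face of [K] off [p];
    the latter has to lie in the link of [p] only if both copies occur. *)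
Lemma in_wed s : (s \in wed K p) =
  if (Some p \in s) && (None \in s) then base s \in K else base s :\ p \in K.
Proof.
case: sK => K0 K1 Kdown.
have decomp : s = (s :&: [set Some p; None]) :|: [set Some v | v in base s :\ p].
  apply/setP => -[v|]; rewrite !inE ?orbF ?andbT; last first.
    by rewrite None_notin_imset orbF.
  rewrite mem_imset_Some !inE -[Some v == Some p]/(v == p).
  by case: (v == p); rewrite ?andbT ?andbF ?orbF.
apply/idP/idP.
  rewrite inE => /orP[] /imset2P[A B]; rewrite ?inE.
    move=> AI /imsetP[t]; rewrite !inE => /andP[tK /andP[ptK _]] -> ->.
    have sub : base (A :|: [set Some v | v in t]) \subset [set p] :|: t.
      apply/subsetP => v; rewrite !inE => /orP[/(subsetP AI)|].
        by rewrite !inE orbF => /eqP[->]; rewrite eqxx.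
      by rewrite mem_imset_Some => ->; rewrite orbT.
    case: ifP => _; apply: Kdown ptK _ => //.
    exact: subset_trans (subD1set _ _) sub.
  move=> /andP[AnI AI] /imsetP[t]; rewrite !inE => /andP[tK pt] -> ->.
  case: ifP => [/andP[]|_].
    rewrite !inE mem_imset_Some (negPf pt) orbF => pA.
    rewrite None_notin_imset orbF => nA; case/eqP: AnI; apply/eqP; rewrite eqEsubset AI.
    by apply/subsetP => x; rewrite !inE => /orP[] /eqP ->.
  apply: Kdown tK _; apply/subsetP => v; rewrite !inE => /andP[vp].
  case/orP => [/(subsetP AI)|]; last by rewrite mem_imset_Some.
  by rewrite !inE orbF => /eqP[vp']; rewrite vp' eqxx in vp.
rewrite inE => H; apply/orP.
case: ifP H => [/andP[ps Ns] bK|nI bK]; [left|right]; rewrite decomp.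
  apply: imset2_f; first by rewrite inE subsetIr.
  apply: imset_f; rewrite !inE; apply/andP; split; last apply/andP; last split.
  - by apply: Kdown bK _; apply: subD1set.
  - by rewrite setD1K ?inE.
  - by rewrite disjoints1 !inE eqxx.
apply: imset2_f.
  rewrite !inE subsetIr andbT; apply/eqP => e; case/negP: nI.
  by move/setIidPr/subsetP: e => e; rewrite !e ?inE ?eqxx ?orbT.
by apply: imset_f; rewrite !inE bK eqxx.
Qed.

Lemma simplicial_wed : simplicial_complex (wed K p).
Proof.
case: sK => K0 K1 Kdown; split.
- rewrite in_wed !inE; apply: Kdown K0 _; apply/subsetP => v.
  by rewrite !inE ?andbF.
- move=> x; rewrite in_wed !inE.
  have -> : (Some p == x) && (None == x) = false by case: x => [v|] //=; rewrite andbF.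
  case: x => [v|]; last by apply: Kdown K0 _; apply/subsetP => w; rewrite !inE ?andbF.
  by apply: Kdown (K1 v) _; apply/subsetP => w; rewrite !inE => /andP[_ /eqP[->]].
- move=> s t; rewrite !in_wed => sW ts.
  have bts : base t \subset base s.
    by apply/subsetP => v; rewrite !inE; apply: (subsetP ts).
  case: ifP => [/andP[pt Nt]|_].
    move: sW; rewrite !(subsetP ts) // => sW; exact: Kdown sW bts.
  case: ifP sW => _ sW; apply: Kdown sW _; last exact: setSD.
  exact: subset_trans (subD1set _ _) bts.
Qed.

(** This is why a map is characteristic over the wedge as soon as its projections
    to both copies of [K] are ([char_map_wed]). *)
Lemma wed_face_copy s : s \in wed K p ->
  exists b, [set v | wedge_copy p b v \in s] \in K.
Proof.
case: sK => K0 K1 Kdown.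
rewrite in_wed => sW.
case: (boolP (Some p \in s)) sW => [ps|nps] /= sW.
  exists (None \in s == false); move: sW; case: (boolP (None \in s)) => [Ns|nNs] /= sW.
    apply: Kdown sW _; apply/subsetP => v; rewrite !inE /wedge_copy.
    by case: eqVneq => // ->.
  apply: Kdown sW _; apply/subsetP => v; rewrite !inE /wedge_copy.
  by case: eqVneq => //= _; rewrite (negPf nNs).
exists false; apply: Kdown sW _; apply/subsetP => v; rewrite !inE /wedge_copy.
by case: eqVneq => //= _; rewrite (negPf nps).
Qed.

End WedgeFaces.

Lemma wedge_complementary (V : finType) (p : V) b :
  complementary [set wedge_vertex p b] (wedge_copy p b).
Proof.
split.
- move=> v w; rewrite /wedge_copy /wedge_vertex.
  by case: eqVneq => [->|nv]; case: eqVneq => [->|nw] //; case: b => //= -[] // e;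
    move: nw nv; rewrite ?e ?eqxx // -?e ?eqxx.
- move=> w; rewrite inE /wedge_copy /wedge_vertex.
  by case: (eqVneq w p) => [_|nw]; case: b => //; apply/eqP => -[wp]; rewrite wp eqxx in nw.
- move=> x; rewrite inE /wedge_copy /wedge_vertex.
  case: x b => [v|] [] xp; first 1 last.
  + by exists v; case: (eqVneq v p) => [->|//].
  + by exists p; rewrite eqxx.
  + by [].
  + by exists v; rewrite ifN //; apply: contra xp => /eqP ->.
Qed.

Section WedgeMaps.
Variables (V : finType) (K : {set {set V}}).
Hypothesis sK : simplicial_complex K.

Lemma char_map_wed N (l : cmap (option V) N) p :
  (forall b s, is_relation l s ->
     supp (fun v => s (wedge_copy p b v)) \in K -> s =1 fun=> 0) ->
  char_map (wed K p) l.
Proof.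
move=> H; apply/(char_mapP _ (simplicial_wed p sK)) => r rW rl.
have [b] := wed_face_copy sK rW.
rewrite (_ : [set v | _] = supp (fun v => r (wedge_copy p b v))); first exact: H.
by apply/setP => v; rewrite !inE.
Qed.

Lemma char_map_wed2 N (l : cmap (option (option V)) N) p q :
  (forall b c s, is_relation l s ->
     supp (fun v => s (wedge2_copy p q b c v)) \in K -> s =1 fun=> 0) ->
  char_map (wed2 K p q) l.
Proof.
move=> H.
have sW := simplicial_wed p sK.
apply/(char_mapP _ (simplicial_wed (Some q) sW)) => r rW rl.
have [c cW] := wed_face_copy sW rW.
have [b bK] := wed_face_copy sK cW.
apply: (H b c) => //; move: bK; congr (_ \in K).
by apply/setP => v; rewrite !inE.
Qed.

Lemma wedge2_complementary (p q : V) b c : p != q ->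
  complementary (wedge2_face p q b c) (wedge2_copy p q b c).
Proof.
move=> npq.
have [inj1 ni1 on1] := wedge_complementary p b.
have [inj2 ni2 on2] := wedge_complementary (Some q) c.
have copy_p : wedge_copy (Some q) c (wedge_vertex p b) = Some (wedge_vertex p b).
  rewrite /wedge_copy ifN //; case: b {inj1 ni1 on1} => //=.
split.
- by move=> v w /inj2/inj1.
- move=> w; rewrite /wedge2_face !inE negb_or.
  have := ni2 (wedge_copy p b w); rewrite inE => ->; rewrite andbT.
  rewrite /wedge2_copy -copy_p (inj_eq inj2).
  by have := ni1 w; rewrite inE.
- move=> x; rewrite /wedge2_face !inE negb_or => /andP[nx1 nx2].
  have [|y xy] := on2 x; first by rewrite inE.
  have [|z yz] := on1 y; last by exists z; rewrite /wedge2_copy -yz.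
  by rewrite inE; apply: contra nx1 => /eqP yp; rewrite xy yp copy_p.
Qed.

(** A map over the wedge in coordinates where the value at [None] = p_2 is the
    first basis vector: its projection at p_2 is [l], and [x] is the new
    coordinate of the other vertices. *)
Definition extend n (l : cmap V n) (x : V -> 'F_2) : cmap (option V) n.+1 :=
  [ffun o => if o is Some v then col_mx (x v)%:M (l v) : 'cV_(1 + n)
             else col_mx 1%:M 0 : 'cV_(1 + n)].

Lemma is_relation_extend n (l : cmap V n) x (s : option V -> 'F_2) :
  is_relation (extend l x) s =
  is_relation l (fun v => s (Some v)) && (s None == \sum_v s (Some v) * x v).
Proof.
rewrite /is_relation.
have -> : \sum_v s v *: extend l x v =
    col_mx (\sum_v s (Some v) * x v + s None)%:M (\sum_v s (Some v) *: l v) :> 'cV_(1 + n).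
  rewrite (bigD1 None) //= [X in _ + X](_ : _ =
      \sum_v (col_mx (s (Some v) *: (x v)%:M) (s (Some v) *: l v) : 'cV_(1 + n)));
    last first.
    rewrite (reindex_omap Some id) /=; last by case.
    apply: eq_big => v; first by rewrite eqxx.
    by move=> _; rewrite ffunE; apply: scale_col_mx.
  have -> : s None *: extend l x None = col_mx (s None)%:M 0 :> 'cV_(1 + n).
    rewrite ffunE; apply: etrans (scale_col_mx _ _ _) _.
    by rewrite scaler0 scale_scalar_mx mulr1.
  have -> : \sum_v col_mx (s (Some v) *: (x v)%:M) (s (Some v) *: l v) =
     col_mx (\sum_v s (Some v) *: (x v)%:M) (\sum_v s (Some v) *: l v) :> 'cV_(1 + n).
    by elim/big_rec3: _ => [|v a b _ _ ->]; rewrite ?col_mx0 ?add_col_mx.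
  apply: etrans (add_col_mx _ _ _ _) _; rewrite add0r; congr col_mx.
  rewrite addrC raddfD /=; congr (_ + _).
  rewrite raddf_sum; apply: eq_bigr => v _; exact: scale_scalar_mx.
set A := (_%:M); set B := (X in col_mx _ X).
have -> : (col_mx A B == 0 :> 'cV_(1 + n)) = (A == 0) && (B == 0) := col_mx_eq0 _ _.
rewrite andbC; congr andb.
have -> : (s None == \sum_v s (Some v) * x v) =
    (\sum_v s (Some v) * x v + s None == 0).
  by rewrite addr_eq0 F2_oppr eq_sym.
rewrite /A.
apply/eqP/eqP => [|->]; last by rewrite raddf0.
by move/matrixP => /(_ 0 0); rewrite !mxE eqxx.
Qed.

End WedgeMaps.

(** * Adjacency and realizable squares in terms of relations *)

Section Realizability.
Variables (V : finType) (n : nat) (K : {set {set V}}).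
Hypothesis sK : simplicial_complex K.
Implicit Types (p q : V) (l c ca cb cg : cmap V n) (r : V -> 'F_2).

Lemma toggleCK p q a b r : toggle p a (toggle q b (toggle p a r)) = toggle q b r.
Proof. by rewrite toggleC toggleK. Qed.

Lemma toggle2K p q a b r : toggle q b (toggle p a (toggle q b (toggle p a r))) = r.
Proof. by rewrite toggleCK toggleK. Qed.

Lemma slide_unique l p a a' r : l p != 0 ->
  is_relation l (toggle p a r) -> is_relation l (toggle p a' r) -> a = a'.
Proof.
move=> lp H H'; have := is_relation_toggle (a := a' + a) lp H.
rewrite toggleD -addrA F2_addxx addr0 => /(_ H') /eqP.
by rewrite addr_eq0 F2_oppr => /eqP ->.
Qed.

Lemma toggle_eq0 l p a r : l p != 0 -> is_relation l r ->
  toggle p a r =1 (fun=> 0) -> r =1 fun=> 0.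
Proof.
move=> lp rl /funext r0.
have a0 : a = 0.
  by apply: (is_relation_toggle lp rl); rewrite r0 is_relation0.
by move=> v; rewrite -[r](toggleK p a) r0 a0 toggle0.
Qed.

(** When [l p i 0] is nonzero, the [i]-th coordinate of the equation expressing
    that a vector is a relation of [l] determines its entry at [p] from the other
    ones. Adding this functional as a new coordinate of an adjacent map records
    the entry at [p] of the neighbouring relation. *)
Definition height l p (i : 'I_n) v : 'F_2 := if v == p then 0 else l v i 0.

Lemma height_slide l p i r a : l p i 0 != 0 ->
  is_relation l (toggle p a r) -> \sum_v r v * height l p i v = r p + a.
Proof.
move=> /F2_neq0 lpi /eqP H; have := congr1 (fun A : 'cV_n => A i 0) H.
rewrite summxE mxE (bigD1 p) //= mxE lpi mulr1 {1}/toggle eqxx => /eqP.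
rewrite addrC addr_eq0 F2_oppr => /eqP <-.
rewrite (bigD1 p) //= /height eqxx mulr0 add0r; apply: eq_bigr => v nv.
by rewrite mxE (negPf nv) toggle_off.
Qed.

Lemma exists_coord l p : l p != 0 -> exists i, l p i 0 != 0.
Proof. by case/matrix0Pn => i [j]; rewrite (ord1 j); exists i. Qed.

Lemma wedge_copy_false p v : wedge_copy p false v = Some v.
Proof. by rewrite /wedge_copy; case: eqVneq => [->|]. Qed.

Lemma wedge_copy_true p v :
  wedge_copy p true v = if v == p then None else Some v.
Proof. by []. Qed.

(** A relation of a map over the wedge restricts to both copies of [K], and the
    restrictions differ at [p] only. Conversely [extend l1 (height l2 p i)] has
    as relations exactly the glued pairs. *)
Lemma adjacentP p l1 l2 : char_map K l1 -> char_map K l2 ->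
  adjacent K p (DJ l1) (DJ l2) <-> slides p l1 l2 /\ slides p l2 l1.
Proof.
move=> K1 K2; split.
  case=> L [_ P1 P2].
  have R1 := Proj_relation (wedge_complementary p false) P1.
  have R2 := Proj_relation (wedge_complementary p true) P2.
  split=> r.
    case/R1 => t tL rt; exists (r p + t (wedge_copy p true p)).
    rewrite -(@off_toggle _ p r (fun v => t (wedge_copy p true v))).
      by apply/R2; exists t.
    by move=> v vp; rewrite rt !wedge_copy_false wedge_copy_true (negPf vp).
  case/R2 => t tL rt; exists (r p + t (wedge_copy p false p)).
  rewrite -(@off_toggle _ p r (fun v => t (wedge_copy p false v))).
    by apply/R1; exists t.
  by move=> v vp; rewrite rt !wedge_copy_false wedge_copy_true (negPf vp).
case=> S12 S21.
have l1p : l1 p != 0 := char_map_neq0 p sK K1.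
have l2p : l2 p != 0 := char_map_neq0 p sK K2.
have [i l2i] := exists_coord l2p.
pose L := extend l1 (height l2 p i); exists L.
pose l b := if b then l2 else l1.
have lK b : char_map K (l b) by case: b.
have key s : is_relation L s -> exists a, [/\
    is_relation l1 (fun v => s (Some v)),
    is_relation l2 (toggle p a (fun v => s (Some v))),
    s None = s (Some p) + a &
    forall b, (fun v => s (wedge_copy p b v)) =
              if b then toggle p a (fun v => s (Some v)) else fun v => s (Some v)].
  rewrite is_relation_extend => /andP[r1 /eqP sN].
  have [a ra] := S12 _ r1; exists a.
  have sN' : s None = s (Some p) + a by rewrite sN (height_slide l2i ra).
  split=> // -[]; apply/funext => v; last by rewrite wedge_copy_false.
  rewrite wedge_copy_true /toggle; case: eqP => [->//|_].
  by rewrite addr0.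
have lift r : is_relation l1 r ->
    exists2 s, is_relation L s & (fun v => s (Some v)) = r.
  move=> r1.
  exists (fun o => if o is Some v then r v else \sum_v r v * height l2 p i v) => //.
  by rewrite is_relation_extend eqxx andbT.
have rel b s : is_relation L s -> is_relation (l b) (fun v => s (wedge_copy p b v)).
  by case/key => a [r1 r2 _ ->]; case: b.
have inj b s : is_relation L s -> (forall v, s (wedge_copy p b v) = 0) ->
    s =1 fun=> 0.
  move=> /key[a [r1 r2 sN sE]] s0.
  have : (fun v => s (wedge_copy p b v)) =1 fun=> 0 by [].
  rewrite sE => {}s0; have s1 : (fun v => s (Some v)) =1 fun=> 0.
    by case: b s0 => // /(toggle_eq0 l1p r1).
  have a0 : a = 0.
    apply: (is_relation_toggle l2p _ r2); rewrite (funext s1).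
    exact: is_relation0.
  by case=> [v|]; rewrite ?s1 // sN s1 a0 addr0.
have onto b r : is_relation (l b) r ->
    exists2 t, is_relation L t & forall v, r v = t (wedge_copy p b v).
  case: b => /= rl; last first.
    have [t tL <-] := lift _ rl; exists t => // v.
    by rewrite wedge_copy_false.
  have [a ra] := S21 _ rl; have [t tL tr] := lift _ ra.
  exists t => //; have [a' [_ r2 _ /(_ true) tE]] := key _ tL.
  suff e : a' = a by move: tE; rewrite tr e toggleK => /(congr1 (fun f => f _)) H v; rewrite (H v).
  by apply: (slide_unique l2p r2); rewrite tr toggleK.
have projE b : Proj n L [set wedge_vertex p b] (wedge_copy p b) = DJ (l b).
  apply: ProjP (wedge_complementary p b) _ _ _.
  - by rewrite cards1 addn1.
  - exact: inj.
  - move=> r; split; first exact: onto.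
    by case=> t /(rel b) + rt; rewrite -(funext rt).
split; [|exact: projE|exact: projE].
apply: char_map_wed => // b s sL sb.
by apply: (inj b) => // v; apply: (proj1 (char_mapP _ sK) (lK b) _ sb (rel b s sL)).
Qed.

Lemma wedge2_copyE p q b (c : bool) v : p != q -> wedge2_copy p q b c v =
  if v == p then Some (wedge_vertex p (~~ b))
  else if v == q then wedge_vertex (Some q) (~~ c) else Some (Some v).
Proof.
move=> npq; rewrite /wedge2_copy /wedge_copy.
case: (eqVneq v p) => [_|_]; last by [].
by case: b => //=; rewrite ifN //; apply: contra npq => /eqP[->].
Qed.

Lemma copy2_corner p q (t : option (option V) -> 'F_2) (b c : bool) : p != q ->
  let r (b c : bool) v := t (wedge2_copy p q b c v) in
  exists x y, [/\ r (~~ b) c = toggle p x (r b c), r b (~~ c) = toggle q y (r b c) &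
    r (~~ b) (~~ c) = toggle q y (toggle p x (r b c))].
Proof.
move=> npq r.
exists (t (Some (wedge_vertex p b)) + t (Some (wedge_vertex p (~~ b)))).
exists (t (wedge_vertex (Some q) c) + t (wedge_vertex (Some q) (~~ c))).
split; apply/funext => v; rewrite /r /toggle !wedge2_copyE // ?negbK;
  case: (eqVneq v p) => [vp|_];
  rewrite ?vp ?(negPf npq) ?addr0 ?[RHS]addrA ?F2_addxx ?add0r //;
  case: (v == q); rewrite ?addr0 ?[RHS]addrA ?F2_addxx ?add0r //;
  by rewrite [RHS]addrAC F2_addxx add0r.
Qed.

Definition corner_map c ca cb cg b b' :=
  if b then if b' then cg else ca else if b' then cb else c.

(** Gluing as in [adjacentP], in both directions at once: [extend] is applied to
    [c] with the heights of [ca] at [p] and of [cb] at [q], and the corner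
    condition at [c] identifies the restrictions to the four copies of [K]. *)
Lemma realizable_squareP p q c ca cb cg : p != q ->
  char_map K c -> char_map K ca -> char_map K cb -> char_map K cg ->
  realizable_square K p q (DJ c) (DJ ca) (DJ cb) (DJ cg) <->
  square p q c ca cb cg.
Proof.
move=> npq Kc Ka Kb Kg; pose l := corner_map c ca cb cg.
have lK b b' : char_map K (l b b') by case: b; case: b'.
split.
  case=> L /= [_ Pc Pa Pb Pg].
  have P b b' : Proj n L (wedge2_face p q b b') (wedge2_copy p q b b') = DJ (l b b').
    by case: b; case: b'.
  have R b b' := Proj_relation (wedge2_complementary b b' npq) (P b b').
  have HC b b' : corner p q (l b b') (l (~~ b) b') (l b (~~ b')) (l (~~ b) (~~ b')).
    move=> r /R[t tL rt]; have [x [y [/= H1 H2 H3]]] := copy2_corner t b b' npq.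
    have -> : r = fun v => t (wedge2_copy p q b b' v) by apply/funext.
    by exists x, y; split; rewrite -?H3 -?H2 -?H1; apply/R; exists t.
  by split; [apply: (HC false false)|apply: (HC true false)|apply: (HC false true)|
    apply: (HC true true)].
case=> Cc Ca Cb Cg.
have cp : c p != 0 := char_map_neq0 p sK Kc.
have cq : c q != 0 := char_map_neq0 q sK Kc.
have cap : ca p != 0 := char_map_neq0 p sK Ka.
have caq : ca q != 0 := char_map_neq0 q sK Ka.
have cbq : cb q != 0 := char_map_neq0 q sK Kb.
have [i cai] := exists_coord cap.
have [j cbj] := exists_coord cbq.
pose y (o : option V) := if o is Some v then height cb q j v else 0.
pose L := extend (extend c (height ca p i)) y; exists L => /=.
have sum_y (s : option V -> 'F_2) :
    \sum_o s o * y o = \sum_v s (Some v) * height cb q j v.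
  rewrite (bigD1 None) //= mulr0 add0r (reindex_omap Some id) /=; last by case.
  by apply: eq_bigl => v; rewrite eqxx.
pose toggles (b b' : bool) x z r := let r' := if b then toggle p x r else r in
  if b' then toggle q z r' else r'.
have key s : is_relation L s -> let r v := s (Some (Some v)) in
    exists x z, [/\ s (Some None) = r p + x, s None = r q + z,
      forall b b', is_relation (l b b') (toggles b b' x z r) &
      forall b b', (fun v => s (wedge2_copy p q b b' v)) = toggles b b' x z r].
  rewrite !is_relation_extend sum_y => /andP[/andP[rc /eqP sp] /eqP sq] r.
  have [x [z [ra rb rg]]] := Cc r rc; exists x, z.
  have {}sp : s (Some None) = r p + x by rewrite sp (height_slide cai ra).
  have {}sq : s None = r q + z by rewrite sq (height_slide cbj rb).
  split=> // b b'; first by case: b; case: b'.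
  apply/funext => v; rewrite wedge2_copyE // /toggles.
  case: (eqVneq v p) => [->|np]; last case: (eqVneq v q) => [->|nq].
  - by case: b; case: b'; rewrite /toggle /= ?eqxx ?(negPf npq) ?addr0.
  - by case: b; case: b'; rewrite /toggle /= ?eqxx ?[q == p]eq_sym ?(negPf npq) ?addr0.
  - by case: b; case: b'; rewrite /toggle /= ?(negPf np) ?(negPf nq) ?addr0.
have lift r : is_relation c r ->
    exists2 s, is_relation L s & (fun v => s (Some (Some v))) = r.
  move=> rc; exists (fun o => match o with
    | Some (Some v) => r v
    | Some None => \sum_v r v * height ca p i v
    | None => \sum_v r v * height cb q j v end) => //.
  by rewrite !is_relation_extend sum_y rc !eqxx.
have rel b b' s : is_relation L s ->
    is_relation (l b b') (fun v => s (wedge2_copy p q b b' v)).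
  by case/key => x [z [_ _ H ->]].
have inj b b' s : is_relation L s ->
    (forall v, s (wedge2_copy p q b b' v) = 0) -> s =1 fun=> 0.
  move=> /key[x [z [sp sq rl sE]]] s0.
  have : (fun v => s (wedge2_copy p q b b' v)) =1 fun=> 0 by [].
  rewrite sE => {}s0.
  have r0 : (fun v => s (Some (Some v))) =1 fun=> 0.
    case: b b' s0 => [] [] //=.
    - move/(toggle_eq0 caq (rl true false)).
      exact: (toggle_eq0 cp (rl false false)).
    - exact: (toggle_eq0 cp (rl false false)).
    - exact: (toggle_eq0 cq (rl false false)).
  have x0 : x = 0.
    apply: (is_relation_toggle cap _ (rl true false)); rewrite (funext r0).
    exact: is_relation0.
  have z0 : z = 0.
    apply: (is_relation_toggle cbq _ (rl false true)); rewrite (funext r0).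
    exact: is_relation0.
  by case=> [[v|]|]; rewrite ?r0 // ?sp ?sq r0 ?x0 ?z0 addr0.
have onto b b' r : is_relation (l b b') r ->
    exists2 t, is_relation L t & forall v, r v = t (wedge2_copy p q b b' v).
  suff H : is_relation (l b b') r -> exists x z, [/\
      is_relation c (toggles b b' x z r),
      is_relation ca (toggle p x (toggles b b' x z r)) &
      is_relation cb (toggle q z (toggles b b' x z r))].
    case/H => x [z [rc ra rb]]; have [t tL tr] := lift _ rc; exists t => //.
    have [x' [z' [_ _ rl tE]]] := key _ tL; rewrite {}tr in rl tE.
    have ex : x' = x := slide_unique cap (rl true false) ra.
    have ez : z' = z := slide_unique cbq (rl false true) rb.
    move=> v; have := congr1 (fun f => f v) (tE b b'); rewrite /= => ->.
    rewrite ex ez /toggles; case: (b); case: (b') => //; by rewrite ?toggle2K ?toggleK.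
  case: b b' => [] [] /= rl.
  - have [x [z [rb ra rc]]] := Cg _ rl; exists x, z; split=> //.
      by rewrite /toggles toggleCK.
    by rewrite /toggles toggleK.
  - have [x [z [rc rg rb]]] := Ca _ rl; exists x, z; split=> //.
    by rewrite /toggles toggleK.
  - have [x [z [rg rc ra]]] := Cb _ rl; exists x, z; split=> //.
      by rewrite /toggles toggleC.
    by rewrite /toggles toggleK.
  - have [x [z [ra rb rg]]] := Cc _ rl; exists x, z; split=> //.
have projE b b' : Proj n L (wedge2_face p q b b') (wedge2_copy p q b b') = DJ (l b b').
  apply: ProjP (wedge2_complementary b b' npq) _ _ _.
  - have ne : Some (wedge_vertex p b) != wedge_vertex (Some q) b'.
      by case: b b' => [] [] //=; apply: contra npq => /eqP[->].
    by rewrite cards2 ne addn2.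
  - exact: inj.
  - move=> r; split; first exact: onto.
    by case=> t /(rel b b') + rt; rewrite -(funext rt).
split; [|exact: (projE false false)|exact: (projE true false)
  |exact: (projE false true)|exact: (projE true true)].
apply: char_map_wed2 => // b b' s sL sb.
by apply: (inj b b') => // v; apply: (proj1 (char_mapP _ sK) (lK b b') _ sb (rel b b' s sL)).
Qed.

End Realizability.

(** * Tangent cones of realizations *)

Section Small.
Variable R : realType.

Lemma small_all (T : finType) (P : T -> R -> Prop) :
  (forall t, exists2 d, 0 < d & forall e, 0 < e <= d -> P t e) ->
  exists2 d, 0 < d & forall e, 0 < e <= d -> forall t, P t e.
Proof.
move=> H.
suff [d d0 Hd] : exists2 d, 0 < d &
    forall e, 0 < e <= d -> {in enum T, forall t, P t e}.
  by exists d => // e /Hd He t; apply: He; rewrite mem_enum.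
elim: (enum T) => [|t s [d d0 Hd]]; first by exists 1.
have [d' d'0 Hd'] := H t; exists (Num.min d d'); first by rewrite lt_min d0.
move=> e; rewrite le_min => /andP[e0 /andP[ed ed']] u.
rewrite inE => /predU1P[->|us]; first by apply: Hd'; rewrite e0.
by apply: Hd => //; rewrite e0.
Qed.

(** An affine function that is nonnegative at arbitrarily small positive
    parameters is nonnegative at 0: closedness without topology. *)
Lemma small_ge0 (a b : R) :
  (forall d, 0 < d -> exists2 e, 0 < e <= d & 0 <= a + e * b) -> 0 <= a.
Proof.
move=> H; rewrite leNgt; apply/negP => a0.
have b0 : 0 < `|b| + 1 by apply: ltr_pwDr.
have [|e /andP[e0 ed]] := H (- a / (2 * (`|b| + 1))).
  by rewrite divr_gt0 ?oppr_gt0 ?mulr_gt0.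
rewrite leNgt => /negP; apply.
have eb : e * b <= e * (`|b| + 1).
  by rewrite ler_pM2l //; apply: le_trans (ler_norm b) _; rewrite lerDl.
have : e * (`|b| + 1) <= - a / 2.
  by move: ed; rewrite ler_pdivlMr ?mulr_gt0 //; lra.
lra.
Qed.

Definition downset (V : finType) (K : {set {set V}}) : Prop :=
  forall s t : {set V}, s \in K -> t \subset s -> t \in K.

Section Points.
Variable V : finType.
Implicit Types (K : {set {set V}}) (x y u : {ffun V -> R}).

Definition carrier x : {set V} := [set v | x v != 0].

Lemma notin_carrier x v : v \notin carrier x -> x v = 0.
Proof. by rewrite inE negbK => /eqP. Qed.

Definition comb (a : R) x (b : R) y : {ffun V -> R} :=
  [ffun v => a * x v + b * y v].

Lemma combE a x b y v : comb a x b y v = a * x v + b * y v.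
Proof. by rewrite ffunE. Qed.

(** The tangent cone of |K| at [x]: directions in which one can leave [x] along a
    segment. *)
Definition tangent K x u : Prop :=
  exists2 d, 0 < d & forall e, 0 < e <= d -> realization K (comb 1 x e u).

Lemma sum_comb a x b y :
  \sum_v comb a x b y v = a * \sum_v x v + b * \sum_v y v.
Proof.
rewrite !mulr_sumr -big_split; apply: eq_bigr => v _ /=; by rewrite ffunE.
Qed.

Lemma ray_gt0 x u : (forall v, 0 <= x v) -> exists2 d, 0 < d &
  forall e, 0 < e <= d -> forall v,
    (x v != 0 -> 0 < comb 1 x e u v).
Proof.
move=> x0; apply: small_all => v.
case: (eqVneq (x v) 0) => [_|nx]; first by exists 1.
have xv : 0 < x v by rewrite lt_def nx x0.
have uv : 0 < `|u v| + 1 by apply: ltr_pwDr.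
exists (x v / (2 * (`|u v| + 1))); first by rewrite divr_gt0 ?mulr_gt0.
move=> e /andP[e0]; rewrite ler_pdivlMr ?mulr_gt0 // => ed _.
rewrite ffunE mul1r.
have : - (e * u v) <= e * (`|u v| + 1).
  rewrite -mulrN ler_pM2l //; apply: le_trans (ler_norm _) _.
  by rewrite normrN lerDl.
lra.
Qed.

Lemma tangentP K x u : downset K -> realization K x ->
  tangent K x u <->
  [/\ \sum_v u v = 0, forall v, x v = 0 -> 0 <= u v &
      carrier x :|: carrier u \in K].
Proof.
move=> Kdown [x0 x1 xK]; have [d d0 Hd] := ray_gt0 u x0; split.
  case=> d' d'0 Hd'.
  pose e := Num.min d d'.
  have e0 : 0 < e by rewrite lt_min d0.
  have ed : 0 < e <= d by rewrite e0 ge_min lexx.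
  have [c0 c1 cK] : realization K (comb 1 x e u).
    by apply: Hd'; rewrite e0 ge_min lexx orbT.
  split.
  - move: c1; rewrite sum_comb x1 mul1r => /eqP.
    by rewrite -subr_eq0 addrAC subrr add0r mulf_eq0 gt_eqF //= => /eqP.
  - move=> v xv; move: (c0 v); rewrite ffunE xv mulr0 add0r pmulr_rge0 //.
  - apply: Kdown cK _; apply/subsetP => v; rewrite !inE.
    case: (eqVneq (x v) 0) => [xv|xv _] /=; last by rewrite gt_eqF // Hd.
    by rewrite ffunE xv mulr0 add0r mulf_eq0 (gt_eqF e0).
case=> u1 u0 xuK; exists d => // e ed; split.
- move=> v; case: (eqVneq (x v) 0) => [xv|xv]; last by rewrite ltW // Hd.
  rewrite ffunE xv mulr0 add0r mulr_ge0 ?u0 //; lra.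
- by rewrite sum_comb u1 x1; lra.
- apply: Kdown xuK _; apply/subsetP => v; rewrite !inE ffunE.
  by apply: contraR; rewrite negb_or !negbK => /andP[/eqP -> /eqP ->]; rewrite !mulr0 addr0.
Qed.

Lemma tangent_ray_carrier K x u : realization K x -> tangent K x u ->
  exists2 d, 0 < d & forall e, 0 < e <= d ->
    realization K (comb 1 x e u) /\
    carrier (comb 1 x e u) = carrier x :|: carrier u.
Proof.
move=> [x0 x1 xK] [d' d'0 Hd']; have [d d0 Hd] := ray_gt0 u x0.
exists (Num.min d d'); first by rewrite lt_min d0.
move=> e; rewrite le_min => /and3P[e0 ed ed'].
split; first by apply: Hd'; rewrite e0.
apply/setP => v; rewrite !inE.
case: (eqVneq (x v) 0) => [xv|xv] /=; last by rewrite gt_eqF // Hd ?e0.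
by rewrite ffunE xv mulr0 add0r mulf_eq0 (gt_eqF e0).
Qed.

(** The tangent directions of the open simplex that contains [x]. *)
Definition flat x u : Prop := \sum_v u v = 0 /\ carrier u \subset carrier x.

Lemma flat_tangent K x u : downset K -> realization K x ->
  flat x u -> tangent K x u.
Proof.
move=> sK rx [u1 ux]; apply/tangentP => //; split=> //.
  move=> v xv; rewrite notin_carrier //; apply/negP => /(subsetP ux).
  by rewrite inE xv eqxx.
by case: rx => _ _; rewrite (setUidPl ux).
Qed.

Lemma flat_comb x u u' a b : flat x u -> flat x u' -> flat x (comb a u b u').
Proof.
move=> [u1 /subsetP ux] [u'1 /subsetP ux']; split.
  by rewrite sum_comb u1 u'1 !mulr0 addr0.
apply/subsetP => v; apply: contraLR => vx; rewrite inE ffunE negbK.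
rewrite !notin_carrier ?mulr0 ?addr0 //.
  by apply: contra vx => /ux'.
by apply: contra vx => /ux.
Qed.

Lemma tangent_comb_flat K x u z a b : downset K ->
  realization K x -> 0 <= a -> tangent K x u -> flat x z ->
  tangent K x (comb a u b z).
Proof.
move=> sK rx a0 /(tangentP _ sK rx)[u1 u0 uK] [z1 /subsetP zx].
have zv v : x v = 0 -> z v = 0.
  by move=> xv; apply: notin_carrier; apply/negP => /zx; rewrite inE xv eqxx.
apply/tangentP => //; split.
- by rewrite sum_comb u1 z1 !mulr0 addr0.
- by move=> v xv; rewrite ffunE zv // mulr0 addr0 mulr_ge0 ?u0.
- apply: sK uK _.
  apply/subsetP => v; rewrite !inE ffunE.
  case: (eqVneq (x v) 0) => //= xv; rewrite zv // mulr0 addr0.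
  by rewrite mulf_eq0 negb_or => /andP[].
Qed.

Definition towards x i : {ffun V -> R} := [ffun v => (v == i)%:R - x v].

Lemma towardsE x i v : towards x i v = (v == i)%:R - x v.
Proof. by rewrite ffunE. Qed.

Lemma towards_tangent K x i : downset K -> realization K x ->
  i |: carrier x \in K -> tangent K x (towards x i).
Proof.
move=> sK rx iK; apply/tangentP => //; case: (rx) => x0 x1 xK; split.
- under eq_bigr do rewrite ffunE; rewrite sumrB x1 (bigD1 i) //= eqxx.
  by rewrite big1 ?addr0 ?subrr // => v /negPf ->.
- by move=> v xv; rewrite ffunE xv subr0 ler0n.
- apply: sK iK _.
  apply/subsetP => v; rewrite !inE ffunE.
  by case: (v == i) => //=; rewrite sub0r oppr_eq0 orbb.
Qed.

End Points.

Section Subdivision.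
Variables (T V : finType) (K' : {set {set T}}) (K : {set {set V}}).
Variable pos : T -> {ffun V -> R}.
Let f := linear_extension pos.
Hypothesis sK' : downset K'.
Hypothesis f_real : forall x, realization K' x -> realization K (f x).
Hypothesis f_inj : forall x y,
  realization K' x -> realization K' y -> f x = f y -> x = y.
Hypothesis f_onto : forall y, realization K y ->
  exists2 x, realization K' x & f x = y.

Lemma linear_comb a x b y : f (comb a x b y) = comb a (f x) b (f y).
Proof.
apply/ffunP => v; rewrite !ffunE !mulr_sumr -big_split.
by apply: eq_bigr => t _; rewrite ffunE /= mulrDl !mulrA.
Qed.

Lemma tangent_image x u : tangent K' x u -> tangent K (f x) (f u).
Proof.
case=> d d0 H; exists d => // e /H/f_real.
by rewrite linear_comb.
Qed.

Lemma tangent_inj x u u' : tangent K' x u -> tangent K' x u' ->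
  f u = f u' -> u = u'.
Proof.
case=> d d0 H [d' d'0 H'] e.
pose c := Num.min d d'; have c0 : 0 < c by rewrite lt_min d0.
have /ffunP : comb 1 x c u = comb 1 x c u'.
  apply: f_inj; last by rewrite !linear_comb e.
    by apply: H; rewrite c0 ge_min lexx.
  by apply: H'; rewrite c0 ge_min lexx orbT.
move=> E; apply/ffunP => v; have := E v; rewrite !ffunE => /addrI.
by apply: mulfI; rewrite gt_eqF.
Qed.

Lemma realization_comb (x y : {ffun T -> R}) a b s :
  s \in K' -> 0 <= a -> 0 <= b -> a + b = 1 ->
  (forall t, 0 <= x t) -> (forall t, 0 <= y t) ->
  \sum_t x t = 1 -> \sum_t y t = 1 ->
  carrier x \subset s -> carrier y \subset s -> realization K' (comb a x b y).
Proof.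
move=> sK a0 b0 ab x0 y0 x1 y1 /subsetP xs /subsetP ys; split.
- by move=> t; rewrite ffunE addr_ge0 ?mulr_ge0.
- by rewrite sum_comb x1 y1 !mulr1.
- apply: sK' sK _.
  apply/subsetP => t; apply: contraLR => ts; rewrite inE ffunE negbK.
  rewrite !notin_carrier ?mulr0 ?addr0 //.
    by apply: contra ts => /ys.
  by apply: contra ts => /xs.
Qed.

(** A subdivision induces a surjection of tangent cones. Points that move along a
    direction w have preimages in |K'|; one simplex contains them for arbitrarily
    small parameters, since there are finitely many simplices. The preimages in
    this simplex lie on a line by injectivity, and the line starts at [x]. *)
Lemma tangent_lift x w : realization K' x -> tangent K (f x) w ->
  exists2 u, tangent K' x u & f u = w.
Proof.
move=> rx [e0 e0_gt0 He0].
pose at_ e z s := [/\ realization K' z, f z = comb 1 (f x) e w & carrier z = s].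
have [s Hs] : exists s, forall d, 0 < d ->
    exists e, 0 < e <= d /\ exists z, at_ e z s.
  apply: contrapT => nos.
  have [|d d0 Hd] := @small_all {set T} (fun s e => e <= e0 -> ~ exists z, at_ e z s).
    move=> s; apply: contrapT => H; apply: nos; exists s => d d0.
    apply: contrapT => H'; apply: H; exists d => // e ed ee0 ez; apply: H'.
    by exists e.
  pose e := Num.min d e0.
  have e_gt0 : 0 < e by rewrite lt_min d0.
  have [|z rz fz] := f_onto (He0 e _); first by rewrite e_gt0 ge_min lexx orbT.
  apply: (Hd e _ (carrier z)); first by rewrite e_gt0 ge_min lexx.
    by rewrite ge_min lexx orbT.
  by exists z.
have [e2 [/andP[e2_gt0 e2_le] [z2 [rz2 fz2 cz2]]]] := Hs e0 e0_gt0.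
have [|e1 [/andP[e1_gt0 e1_le] [z1 [rz1 fz1 cz1]]]] := Hs (e2 / 2); first lra.
have e12 : e1 < e2 by lra.
have n12 : e2 - e1 != 0 by rewrite subr_eq0 gt_eqF.
have sK : s \in K' by rewrite -cz2; case: rz2.
pose u := comb (e2 - e1)^-1 z2 (- (e2 - e1)^-1) z1.
have fu : f u = w.
  rewrite linear_comb fz1 fz2; apply/ffunP => v; rewrite !ffunE; field.
  exact: n12.
pose x0 := comb 1 z2 (- e2) u.
have collinear e z : 0 < e < e1 -> at_ e z s -> z = comb 1 x0 e u.
  move=> /andP[e_gt0 ee1] [rz fz cz].
  have ne : e2 - e != 0 by rewrite subr_eq0 gt_eqF //; lra.
  (* z1 lies between z2 and z, which have the same carrier. *)
  pose a := (e1 - e) / (e2 - e); pose b := (e2 - e1) / (e2 - e).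
  have ab : a + b = 1 by rewrite /a /b; field.
  have /ffunP E : z1 = comb a z2 b z.
    apply: f_inj => //.
      apply: (realization_comb sK); rewrite ?cz ?cz2 //;
        [| |by case: rz2|by case: rz|by case: rz2|by case: rz].
      - by rewrite divr_ge0 //; lra.
      - by rewrite divr_ge0 //; lra.
    rewrite linear_comb fz fz1 fz2; apply/ffunP => v; rewrite !ffunE /a /b.
    by field.
  apply/ffunP => t; have := E t; rewrite !ffunE /a /b => ->.
  by field; rewrite n12 ne.
have z1E : z1 = comb 1 x0 e1 u.
  by apply/ffunP => t; rewrite !ffunE; field.
have x0_ge0 t : 0 <= x0 t.
  apply: (small_ge0 (b := u t)) => d d0.
  have [|e [/andP[e_gt0 ed] [z atz]]] := Hs (Num.min d (e1 / 2)).
    by rewrite lt_min d0; lra.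
  move: ed; rewrite le_min => /andP[ed ee1].
  exists e; first by rewrite e_gt0.
  have := collinear e z _ atz; case: atz => [[z0 _ _] _ _] zE.
  have := z0 t; rewrite zE ?ffunE ?mul1r //; lra.
have [z1_ge0 z1_sum _] := rz1; have [z2_ge0 z2_sum _] := rz2.
have u_sum : \sum_t u t = 0 by rewrite sum_comb z1_sum z2_sum !mulr1 subrr.
have x0_sum : \sum_t x0 t = 1 by rewrite sum_comb z2_sum u_sum mulr0 addr0 mulr1.
have x0s : carrier x0 \subset s.
  apply/subsetP => t; apply: contraLR => ts; rewrite inE negbK !ffunE.
  by rewrite !notin_carrier ?cz1 ?cz2 // !mulr0 addr0 mulr0 addr0.
have rx0 : realization K' x0.
  have := realization_comb sK (@ler01 R) (lexx 0) (addr0 1) x0_ge0 x0_ge0 x0_sum x0_sum x0s x0s.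
  by congr realization; apply/ffunP => t; rewrite ffunE mul1r mul0r addr0.
have x0x : x0 = x.
  apply: f_inj => //; rewrite linear_comb fz2 fu; apply/ffunP => v.
  by rewrite !ffunE; ring.
exists u => //; exists e1 => // e /andP[e_gt0 ee1]; rewrite -x0x.
have -> : comb 1 x0 e u = comb (1 - e / e1) x0 (e / e1) z1.
  apply/ffunP => t; rewrite z1E !ffunE; field.
  by rewrite n12 gt_eqF.
apply: (realization_comb sK) => //; rewrite ?cz1 //.
- by rewrite subr_ge0 ler_pdivrMr // mul1r.
- by rewrite divr_ge0 // ltW.
- by rewrite subrK.
Qed.

(** The opposite of a flat direction is tangent too, so the image has nonnegative
    and nonpositive entries off the support of the image of [x]. *)
Lemma flat_image x u v : realization K' x -> downset K ->
  flat x u -> f x v = 0 -> f u v = 0.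
Proof.
move=> rx sK fl fxv.
have fl' : flat x (comb (-1) u 0 u) by apply: flat_comb.
have /(tangentP _ sK (f_real rx))[_ ge0 _] := tangent_image (flat_tangent sK' rx fl).
have := tangent_image (flat_tangent sK' rx fl').
case/(tangentP _ sK (f_real rx)) => _ le0 _.
have := le0 v fxv; rewrite linear_comb ffunE mul0r addr0 mulN1r oppr_ge0 => fu_le0.
by apply/eqP; rewrite eq_le fu_le0 ge0.
Qed.

End Subdivision.

(** Otherwise the tangent cone of |L| at an interior point y of [s] is a half-space
    bounded by the flat directions. A common subdivision transports this to the
    tangent cone of the boundary of the simplex at the corresponding point z: there,
    any two directions that are not flat for the subdivision have positive multiples
    that differ by a flat one. But if the carrier of z is a facet, the cone at z contains the
    opposite of each of its directions; if not, the directions towards two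
    vertices outside the carrier are independent modulo the carrier. *)
Lemma no_free_face (V : finType) (L : {set {set V}}) n (s : {set V}) w :
  downset L -> PL_sphere R L n -> s != set0 -> w \notin s ->
  w |: s \in L -> exists2 t, t \in L & (s \subset t) && ~~ (t \subset w |: s).
Proof.
move=> sL [T [K' [[_ _ sK'] [p1 [_ fR fI fS]] [p2 [_ gR gI gS]]]]] /set0Pn[v0 v0s] ws FL.
apply: contrapT => free.
have {}free t : t \in L -> s \subset t -> t \subset w |: s.
  move=> tL st; apply: contrapT => /negP nt; apply: free; exists t => //.
  by rewrite st.
pose f := @linear_extension R T V p1; pose g := @linear_extension R T 'I_n.+1 p2.
have sD : downset (simplex_boundary n).
  by move=> t t'; rewrite !inE => tD t't; apply: sub_proper_trans tD.
(* A carrier of maximal dimension among the points over the open simplex s makes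
   all directions of s images of flat directions. *)
pose good (t : {set T}) :=
  `[< exists x, [/\ realization K' x, carrier (f x) = s & carrier x = t] >].
have [t0 gt0] : exists t, good t.
  pose y : {ffun V -> R} := [ffun v => if v \in s then #|s|%:R^-1 else 0].
  have s0 : #|s|%:R != 0 :> R.
    by rewrite pnatr_eq0 -lt0n; apply/card_gt0P; exists v0.
  have cy : carrier y = s.
    by apply/setP => v; rewrite inE ffunE; case: ifP; rewrite ?invr_neq0 ?eqxx.
  have [|x rx fx] := fS y.
    split.
    - by move=> v; rewrite ffunE; case: ifP; rewrite ?invr_ge0 ?ler0n.
    - under eq_bigr do rewrite ffunE.
      by rewrite -big_mkcond /= sumr_const -[_ *+ _]mulr_natr mulVf.
    - rewrite -/(carrier y) cy; apply: sL FL _; exact: subsetUr.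
  by exists (carrier x); apply/asboolP; exists x; split; rewrite // /f fx.
case: (@arg_maxnP _ t0 good (fun t => #|t|) gt0) => _ /asboolP[x [rx fxs <-]] maxx.
set y := f x in fxs; set z := g x.
have ry : realization L y := fR _ rx.
have rz : realization (simplex_boundary n) z := gR _ rx.
have onto_flat u : flat y u -> exists2 xi, flat x xi & f xi = u.
  move=> fu; have [xi txi fxi] :=
    tangent_lift sK' fI fS rx (flat_tangent sL ry fu).
  exists xi => //.
  have [d d0 Hd] := tangent_ray_carrier rx txi.
  have [d' d'0 Hd'] := tangent_ray_carrier ry (flat_tangent sL ry fu).
  pose e := Num.min d d'; have e0 : 0 < e by rewrite lt_min d0.
  have [re ce] : realization K' (comb 1 x e xi) /\
      carrier (comb 1 x e xi) = carrier x :|: carrier xi.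
    by apply: Hd; rewrite e0 ge_min lexx.
  have [rf cf] : realization L (comb 1 y e u) /\
      carrier (comb 1 y e u) = carrier y :|: carrier u.
    by apply: Hd'; rewrite e0 ge_min lexx orbT.
  have gs : good (carrier x :|: carrier xi).
    apply/asboolP; exists (comb 1 x e xi); split=> //.
    by rewrite /f linear_comb fxi -/f -/y cf (setUidPl fu.2).
  have le := maxx _ gs.
  split; first by case/(tangentP _ sK' rx): txi.
  by apply/setUidPl/eqP; rewrite eq_sym eqEcard subsetUl.
have split_w eta : tangent L y eta ->
    0 <= eta w /\ (eta w = 0 -> flat y eta).
  move/(tangentP _ sL ry) => [e1 e0 eL]; split.
    by apply: e0; apply: notin_carrier; rewrite fxs.
  move=> ew; split=> //; rewrite fxs; apply/subsetP => v ve.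
  have := free _ eL; rewrite fxs => /(_ (subsetUl _ _)) /subsetP/(_ v).
  rewrite inE ve orbT !inE => /(_ isT) /orP[/eqP vw|//].
  by rewrite inE vw ew eqxx in ve.
have tx u : flat x u -> tangent K' x u by apply: flat_tangent.
have pos_w xi : tangent K' x xi -> ~ flat x xi -> 0 < f xi w.
  move=> txi nxi; have [ge0 eq0] := split_w _ (tangent_image fR txi).
  rewrite lt_def ge0 andbT; apply/eqP => /eq0/onto_flat[ze fze] e.
  by apply: nxi; rewrite (tangent_inj fI txi (tx _ fze)) // -e.
(* Both images have positive entries at w; clear the entry at w. *)
have prop xi xi' : tangent K' x xi -> ~ flat x xi -> tangent K' x xi' ->
    ~ flat x xi' -> exists a b ze, [/\ 0 < a, 0 < b, flat x ze &
      comb b xi 0 ze = comb a xi' 1 ze].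
  move=> t n1 t' n1'; pose a := f xi w; pose b := f xi' w.
  have a0 : 0 < a by apply: pos_w.
  have b0 : 0 < b by apply: pos_w.
  have [ze fze fe] : exists2 ze, flat x ze & f ze = comb b (f xi) (- a) (f xi').
    apply: onto_flat; case/(tangentP _ sL ry): (tangent_image fR t) => s1 _ c1.
    case/(tangentP _ sL ry): (tangent_image fR t') => s2 _ c2.
    split; first by rewrite sum_comb s1 s2 !mulr0 addr0.
    apply/subsetP => v; rewrite fxs; apply: contraLR => vs; rewrite inE negbK ffunE.
    have [->|vw] := eqVneq v w; first by rewrite -/a -/b; apply/eqP; ring.
    have out eta : carrier y :|: carrier eta \in L -> eta v = 0.
      move=> /free; rewrite fxs => /(_ (subsetUl _ _)) /subsetP sub.
      apply: notin_carrier; apply/negP => ve; have := sub v.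
      by rewrite inE ve orbT !inE (negPf vw) (negPf vs) => /(_ isT).
    by rewrite !out // !mulr0 addr0.
  exists a, b, ze; split=> //; apply: (tangent_inj fI (x := x)).
  - by apply: tangent_comb_flat => //; apply: ltW.
  - by apply: tangent_comb_flat => //; apply: ltW.
  - rewrite !linear_comb -/f fe; apply/ffunP => v; rewrite !ffunE; ring.
have flat_z xi : flat x xi -> flat z (g xi).
  move=> fxi; split.
    by case/(tangentP _ sD rz): (tangent_image gR (tx _ fxi)).
  apply/subsetP => i; apply: contraLR; rewrite !inE !negbK => /eqP zi.
  by rewrite (flat_image sK' gR rx sD fxi zi).
have lift_z eta : tangent (simplex_boundary n) z eta ->
    exists2 xi, tangent K' x xi & g xi = eta.
  by move=> teta; apply: tangent_lift teta.
have [xi0 txi0 gxi0] : exists2 xi, tangent K' x xi & ~ flat x xi.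
  have tu0 : tangent L y (towards y w) by apply: towards_tangent; rewrite ?fxs.
  have [xi txi fxi] := tangent_lift sK' fI fS rx tu0; exists xi => // fl.
  have yw : y w = 0 by apply: notin_carrier; rewrite fxs.
  have := flat_image sK' fR rx sL fl yw; rewrite fxi ffunE eqxx yw subr0.
  by move/eqP; rewrite oner_eq0.
have zD : carrier z \proper [set: 'I_n.+1] by case: rz => _ _; rewrite inE.
have [[i iz iD]|full] : (exists2 i, i \notin carrier z &
    i |: carrier z \proper [set: 'I_n.+1]) \/
    (forall t : {set 'I_n.+1}, carrier z \subset t -> t \proper [set: 'I_n.+1] -> t = carrier z).
  apply: contrapT => /not_orP[H1 H2]; apply: H2 => t zt tD.
  apply/setP/subset_eqP; rewrite zt andbT; apply/subsetP => i it.
  apply: contrapT => /negP iz; apply: H1; exists i => //.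
  by apply: sub_proper_trans tD; rewrite subUset sub1set it.
- have [_ [j _ jn]] := properP iD; move: jn; rewrite !inE negb_or => /andP[ji jz].
  have jD : j |: carrier z \proper [set: 'I_n.+1].
    apply/properP; split; first exact: subsetT.
    by exists i; rewrite !inE // negb_or eq_sym ji; move: iz; rewrite inE.
  have side k : k \notin carrier z -> k |: carrier z \proper [set: 'I_n.+1] ->
      exists xi, [/\ tangent K' x xi, ~ flat x xi & g xi = towards z k].
    move=> kz kD; have [|xi txi gxi] := lift_z (towards z k).
      by apply: towards_tangent; rewrite // inE.
    exists xi; split=> // /flat_z[_ /subsetP/(_ k)].
    rewrite gxi inE ffunE (notin_carrier kz) subr0 eqxx oner_eq0 => /(_ isT).
    exact/negP.
  have [xi [ti ni gi]] := side i iz iD.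
  have jz' : j \notin carrier z by rewrite inE.
  have [xj [tj nj gj]] := side j jz' jD.
  have [a [b [ze [a0 b0 fze E]]]] := prop _ _ ti ni tj nj.
  have := congr1 (fun u => g u i) E; rewrite /g !linear_comb -/g gi gj !combE !towardsE.
  have -> : g ze i = 0 by exact: (flat_image sK' gR rx sD fze (notin_carrier iz)).
  rewrite eqxx [i == j]eq_sym (negPf ji) (notin_carrier iz) mulr1n mulr0n; lra.
have gz : flat z (g xi0).
  case/(tangentP _ sD rz): (tangent_image gR txi0) => s1 _ cD; split=> //.
  apply/setUidPl; apply: full; first exact: subsetUl.
  by move: cD; rewrite inE.
have [|xi1 txi1 gxi1] := lift_z (comb (-1) (g xi0) 0 (g xi0)).
  by apply: flat_tangent => //; apply: flat_comb.
have nxi1 : ~ flat x xi1.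
  move=> fl; have fl' : flat x (comb (-1) xi1 0 xi1) by apply: flat_comb.
  apply: gxi0; rewrite (tangent_inj gI txi0 (tx _ fl')) //.
  rewrite linear_comb -/g gxi1; apply/ffunP => i; rewrite !ffunE; ring.
have [a [b [ze [a0 b0 fze E]]]] := prop _ _ txi0 gxi0 txi1 nxi1.
have E' : comb (a + b) xi0 0 ze = ze.
  apply: (tangent_inj gI (x := x)); last 1 first.
  - have := congr1 g E; rewrite /g !linear_comb -/g gxi1 => /ffunP H.
    by apply/ffunP => i; have := H i; rewrite !ffunE; lra.
  - by apply: tangent_comb_flat => //; rewrite addr_ge0 // ltW.
  - exact: tx.
apply: gxi0; have -> : xi0 = comb (a + b)^-1 ze 0 ze.
  apply/ffunP => t; have /ffunP/(_ t) := E'; rewrite !ffunE => <-.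
  by rewrite !mul0r !addr0 mulKf // gt_eqF // addr_gt0.
exact: flat_comb.
Qed.
End Small.

(** * The number of vertices of a seed *)

Section Seeds.
Variable R : realType.
Variables (V : finType) (L : {set {set V}}) (n : nat).
Implicit Types (s t F G : {set V}) (v w : V).
Hypotheses (sL : simplicial_complex L) (pL : pure L n) (spL : PL_sphere R L n).

Lemma face_in_facet s : s \in L -> exists2 F, facet L F & s \subset F.
Proof. by move=> sL'; have [F ? ?] := maxset_exists sL'; exists F. Qed.

Lemma facet_in F : facet L F -> F \in L.
Proof. exact: maxsetp. Qed.

(** A facet F through [w] and not through [v] shares its ridge F \ w with another
    facet, which avoids [w] and hence is obtained by exchanging [w] for [v]. *)
Lemma transversal_swap v w s : v != w -> [set v; w] \in L ->
  (forall F, facet L F -> (v \in F) || (w \in F)) ->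
  v \notin s -> w \notin s -> w |: s \in L -> v |: s \in L.
Proof.
case: (sL) => _ _ down vw eL tr vs ws wsL.
have [F fF /subsetP sF] := face_in_facet wsL.
have wF : w \in F by apply: sF; rewrite setU11.
case: (boolP (v \in F)) => vF.
  apply: down (facet_in fF) _; apply/subsetP => x; rewrite !inE.
  by case/predU1P => [->//|xs]; apply: sF; rewrite inE xs orbT.
have n2 : (1 < n)%N.
  have [E fE eE] := face_in_facet eL.
  by rewrite -(pL fE); apply: leq_trans (subset_leq_card eE); rewrite cards2 vw.
have cF : #|F :\ w| = n.-1 by have := cardsD1 w F; rewrite wF (pL fF) => ->.
have [|||t tL /andP[st nt]] := no_free_face (s := F :\ w) (w := w) down spL.
- by rewrite -card_gt0 cF -subn1 subn_gt0.
- by rewrite !inE eqxx.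
- by rewrite setD1K // facet_in.
rewrite setD1K // in nt; have [x xt xF] := subsetPn nt.
have [F' fF' /subsetP tF'] := face_in_facet tL.
have eF' : x |: (F :\ w) = F'.
  apply/eqP; rewrite eqEcard; apply/andP; split.
    apply/subsetP => y /setU1P[->|/(subsetP st)/tF'//]; exact: tF'.
  rewrite cardsU1 !inE (negPf xF) andbF cF (pL fF') add1n prednK //.
  exact: ltnW.
have wF' : w \notin F'.
  by rewrite -eF' !inE eqxx /= orbF; apply: contraNneq xF => <-.
have vF' : v \in F' by have := tr _ fF'; rewrite (negPf wF') orbF.
apply: down (facet_in fF') _; apply/subsetP => y /setU1P[->//|ys].
rewrite -eF' !inE (sF y) ?inE ?ys ?orbT // andbT.
by apply/orP; right; apply: contraNneq ws => <-.
Qed.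

(** By [transversal_swap] the links of [v] and [w] agree off [v] and [w], and every
    face that avoids both extends by either; thus L is the wedge at [v] of the
    link of [w]. *)
Lemma transversal_edge_not_seed v w : v != w -> [set v; w] \in L ->
  (forall F, facet L F -> (v \in F) || (w \in F)) -> ~ seed L.
Proof.
move=> vw eL tr; have := sL => -[L0 L1 down].
have swap := transversal_swap vw eL tr.
have swap' : forall s, v \notin s -> w \notin s -> v |: s \in L -> w |: s \in L.
  move=> s vs ws; apply: transversal_swap => //; first by rewrite eq_sym.
    by rewrite setUC.
  by move=> F /tr; rewrite orbC.
have addw s : v \notin s -> w \notin s -> s \in L -> w |: s \in L.
  move=> vs ws sL'; have [F fF /subsetP sF] := face_in_facet sL'.
  have sub x : x \in F -> x |: s \in L.
    move=> xF; apply: down (facet_in fF) _.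
    by apply/subsetP => y /setU1P[->//|]; apply: sF.
  by have /orP[/sub/(swap' _ vs ws)|/sub] := tr F fF.
pose W : finType := {x : V | x != w}.
pose p : W := exist _ v vw.
pose K : {set {set W}} := [set s : {set W} | w |: [set val x | x in s] \in L].
pose f (o : option W) : V := if o is Some x then val x else w.
have f_inj : injective f.
  move=> [x|] [y|] //=; first by move/val_inj ->.
    by move=> e; have := valP x; rewrite /= e eqxx.
  by move=> e; have := valP y; rewrite /= -e eqxx.
have f_bij : bijective f.
  exists (insub : V -> option W) => [[x|]|y] /=.
  - by rewrite valK.
  - by rewrite insubN // eqxx.
  - by case: insubP => [x _ //|]; rewrite negbK => /eqP.
have val_w (s : {set W}) : w \in [set val x | x in s] = false.
  by apply/imsetP => -[x _ e]; have := valP x; rewrite /= -e eqxx.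
have sK : simplicial_complex K.
  split.
  - by rewrite inE imset0 setU0.
  - move=> x; rewrite inE imset_set1.
    have [->|xv] := eqVneq (val x) v; first by rewrite setUC.
    by apply: addw; rewrite ?inE 1?eq_sym ?(valP x) // L1.
  - move=> s t; rewrite !inE => sW ts; apply: down sW _.
    exact/setUS/imsetS.
move/(_ W K p f sK f_bij); apply; apply/setP => t.
have key : f @^-1: t \in wed K p = (t \in L).
  rewrite (in_wed p sK) !inE /=.
  have base_t : [set val x | x in base (f @^-1: t)] = t :\ w.
    apply/setP => y; rewrite !inE; apply/imsetP/andP.
      by case=> x; rewrite !inE /= => xt ->; rewrite xt (valP x).
    by case=> yw yt; exists (exist _ y yw); rewrite // !inE.
  have base_tp : [set val x | x in base (f @^-1: t) :\ p] = t :\ w :\ v.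
    apply/setP => y; rewrite !inE; apply/imsetP/and3P.
      case=> x; rewrite !inE => /andP[xp xt] ->; split=> //; last exact: (valP x).
    case=> yv yw yt; exists (exist _ y yw); rewrite // !inE yt andbT.
    by apply: contra yv => /eqP/(congr1 val) /= ->.
  case: (boolP ((v \in t) && (w \in t))) => [/andP[vt wt]|nvw].
    by rewrite base_t setD1K.
  rewrite base_tp; set s := t :\ w :\ v.
  have vs : v \notin s by rewrite !inE eqxx.
  have ws : w \notin s by rewrite !inE eqxx andbF.
  apply/idP/idP => [wsL|tL]; last first.
    apply: addw => //; apply: down tL _.
    by apply/subsetP => y; rewrite !inE => /and3P[].
  move: nvw; rewrite negb_and => /orP[vt|wt].
    apply: down wsL _; apply/subsetP => y yt; rewrite !inE yt andbT.
    by case: (eqVneq y w) => //= _; rewrite ?andbT; apply: contraNneq vt => <-.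
  have := swap _ vs ws wsL; move/down; apply.
  apply/subsetP => y yt; rewrite !inE yt andbT.
  by case: (eqVneq y v) => //= _; apply: contraNneq wt => <-.
rewrite -key; apply/imsetP/idP => [[s sW ->]|tW].
  rewrite (_ : f @^-1: _ = s) //; apply/setP => o; rewrite inE mem_imset //.
exists (f @^-1: t) => //; apply/setP => y; apply/idP/imsetP.
  by case: f_bij => g gK fK yt; exists (g y); rewrite ?inE ?fK.
by case=> o; rewrite inE => ot ->.
Qed.

Variable l : cmap V n.
Hypothesis lL : char_map L l.

(** The values of [l] on a facet form a basis. *)
Lemma facet_relation F u : facet L F -> u \notin F ->
  exists r, [/\ is_relation l r, r u = 1 & supp r \subset u |: F].
Proof.
move=> fF uF; have /forall_inP/(_ _ fF) fr := lL.
have full : <<[seq l v | v <- enum F]>>%VS = fullv.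
  apply/eqP; rewrite eqEdim subvf /= dimvf (eqP fr) size_map -cardE (pL fF).
  by rewrite /dim /= muln1.
have : l u \in <<[seq l v | v <- enum F]>>%VS by rewrite full memvf.
case/(span_mapP l _ (enum_uniq _)) => r; rewrite big_enum /= => lu.
exists (fun v => if v == u then 1 else if v \in F then r v else 0).
split; last 2 first.
- by rewrite eqxx.
- apply/subsetP => v; rewrite !inE; case: (eqVneq v u) => //= _.
  by case: ifP => //; rewrite eqxx.
rewrite /is_relation (bigD1 u) //= eqxx scale1r {1}lu.
rewrite [X in _ + X](_ : _ = \sum_(v in F) r v *: l v) ?F2_double //.
rewrite (bigID (mem F)) /= [X in _ + X]big1 ?addr0; last first.
  by move=> v /andP[/negPf -> /negPf ->]; rewrite scale0r.
apply: eq_big => [v|v /andP[/negPf -> ->] //].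
by case: (eqVneq v u) => [->|_] //=; rewrite (negPf uF).
Qed.

(** The relations attached to the #|V| - n vertices outside a fixed facet form a
    basis of the space of relations. The code of a vertex lists its values on
    this basis; vertices with the same code have equal entries in every relation,
    so by [facet_relation] each facet meets any two of them. Among three such
    vertices, two lie in the fixed facet and span an edge that meets every
    facet. *)
Lemma seed_bound : seed L -> (#|V| <= 2 * 2 ^ (#|V| - n))%N.
Proof.
move=> seedL; rewrite leqNgt; apply/negP => big.
have [L0 L1 down] := sL.
have [F fF _] := face_in_facet L0.
have /choice[rr Hrr] u : exists r, u \notin F ->
    [/\ is_relation l r, r u = 1 & supp r \subset u |: F].
  case: (boolP (u \in F)) => uF; first by exists (fun=> 0).
  by have [r ?] := facet_relation fF uF; exists r.
pose code (v : V) : {set V} := [set u in ~: F | rr u v != 0].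
have codeF v : code v \in powerset (~: F).
  by rewrite powersetE; apply/subsetP => u; rewrite inE => /andP[].
have [A] : exists A : {set V}, (2 < #|[set v | code v == A]|)%N.
  apply: contrapT => small.
  have : (#|V| <= \sum_(A in powerset (~: F)) 2)%N.
    rewrite -sum1_card (partition_big code (mem (powerset (~: F)))) //=.
    apply: leq_sum => A _; rewrite sum1_card leqNgt; apply/negP => lt2.
    by apply: small; exists A; rewrite cardsE.
  rewrite sum_nat_const card_powerset mulnC cardsCs setCK (pL fF).
  by rewrite leqNgt big.
case/card_gt2P => a [b [d [[]]]]; rewrite !inE => /eqP ca /eqP cb /eqP cd.
case=> ab bd da.
(* r is the combination r' of the basis relations, as they agree off the face F. *)
have same v w r : code v = code w -> is_relation l r -> r v = r w.
  move=> cvw rl.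
  pose r' x := \sum_(u in ~: F) r u * rr u x.
  have r'l : is_relation l r'.
    rewrite /is_relation /r'; under eq_bigr do rewrite scaler_suml.
    rewrite exchange_big big1 //= => u; rewrite inE => uF.
    have [/eqP ru _ _] := Hrr u uF.
    under eq_bigr do rewrite -scalerA.
    by rewrite -scaler_sumr ru scaler0.
  have r'E x : x \notin F -> r' x = r x.
    move=> xF; rewrite /r' (bigD1 x) ?inE //= big1.
      by have [_ -> _] := Hrr x xF; rewrite mulr1 addr0.
    move=> u /andP[]; rewrite inE => uF ux; have [_ _ /subsetP su] := Hrr u uF.
    rewrite (@notin_supp _ (rr u)) ?mulr0 //; apply: contra xF => /su.
    by rewrite !inE eq_sym (negPf ux).
  have z : (fun x => r x + r' x) =1 fun=> 0.
    apply: (proj1 (char_mapP _ sL) lL); last exact: is_relationD.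
    apply: down (facet_in fF) _; apply/subsetP => x; rewrite inE.
    by apply: contraR => xF; rewrite r'E // F2_addxx.
  have rE x : r x = r' x.
    have := z x; case: (F2P (r x)) => ->; case: (F2P (r' x)) => -> //.
  rewrite !rE /r'; apply: eq_bigr => u uF; congr (_ * _).
  have : (u \in code v) = (u \in code w) by rewrite cvw.
  rewrite !inE in uF *; rewrite uF /=.
  by case: (F2P (rr u v)) => ->; case: (F2P (rr u w)) => ->.
have tr v w : v != w -> code v = code w -> forall G, facet L G ->
    (v \in G) || (w \in G).
  move=> vw cvw G fG; apply: contrapT => /negP; rewrite negb_or => /andP[vG wG].
  have [r [rl rv /subsetP rG]] := facet_relation fG vG.
  have := same _ _ _ cvw rl; rewrite rv => e.
  have : w \in supp r by rewrite inE -e oner_eq0.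
  by move/rG; rewrite !inE eq_sym (negPf vw) (negPf wG).
have noedge v w : v != w -> code v = code w -> v \in F -> w \in F -> False.
  move=> vw cvw vF wF; apply: (transversal_edge_not_seed vw _ (tr _ _ vw cvw) seedL).
  by apply: down (facet_in fF) _; rewrite subUset !sub1set vF.
have cab : code a = code b by rewrite ca cb.
have cbd : code b = code d by rewrite cb cd.
have cda : code d = code a by rewrite cd ca.
have := tr _ _ ab cab _ fF; have := tr _ _ bd cbd _ fF; have := tr _ _ da cda _ fF.
case: (boolP (a \in F)) => aF; case: (boolP (b \in F)) => bF;
  case: (boolP (d \in F)) => dF //= _ _ _.
- exact: (noedge _ _ ab).
- exact: (noedge _ _ ab).
- exact: (noedge _ _ da).
- exact: (noedge _ _ bd).
Qed.

End Seeds.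

(** * The order on the nodes *)

Section NodeOrder.
Variables (m : nat) (J : 'I_m -> nat).
Notation node := {dffun forall i, 'I_(J i)}.
Implicit Types u v w z : node.

Definition pdepth v : nat := count (fun i => (v i : nat) != 0%N) (enum 'I_m).

Definition values (s : seq 'I_m) v : seqlexi nat := [seq (v i : nat) | i <- s].

(** With the depth as first entry, the order on the nodes is the lexicographic
    order on these sequences. *)
Definition key v : seqlexi nat := pdepth v :: values (enum 'I_m) v.

Lemma result_depth v : result (depth v) = pdepth v.
Proof.
rewrite /depth result_foldM; set f := (X in foldl X).
suff H s d : foldl f d s = (d + count (fun i => (v i : nat) != 0) s)%N by rewrite H.
elim: s d => [|i s IHs] d /=; first by rewrite addn0.
by rewrite IHs /f !resE; case: (_ != _); rewrite ?addSnnS ?add0n.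

Qed.

Lemma result_lex_compare v w :
  (if result (lex_compare v w) is Lt then true else false) =
  (values (enum 'I_m) v < values (enum 'I_m) w)%O.
Proof.
rewrite /lex_compare result_foldM.
set f := (X in foldl X).
have stop c s : c <> Eq -> foldl f c s = c.
  by elim: s => //= i s IHs; case: c IHs => // IHs _; apply: IHs.
elim: (enum 'I_m) => [|i s IHs] /=; first by rewrite ltxx.
rewrite /values /= Order.SeqLexiOrder.Exports.ltxi_cons -/(values s v) -/(values s w).
rewrite /f !resE -/f !leEnat.
by case: (ssrnat.ltngtP (v i) (w i)) => e; rewrite ?IHs ?stop.

Qed.

Lemma result_prec v w : result (prec v w) = (key v < key w)%O.
Proof.
rewrite /prec !result_bind !result_depth /key.
rewrite Order.SeqLexiOrder.Exports.ltxi_cons !leEnat result_if.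
have [e|ne] := eqVneq (pdepth v) (pdepth w).
  by rewrite e leqnn /= result_bind result_ret result_lex_compare.
by rewrite result_ret; case: (ssrnat.ltngtP (pdepth v) (pdepth w)) ne.

Qed.

Lemma values_inj v w : values (enum 'I_m) v = values (enum 'I_m) w -> v = w.
Proof.
move=> e; apply/ffunP => i; apply: val_inj => /=.
have : {in enum 'I_m, forall i, (v i : nat) = w i}.
  exact/eq_in_map.
by apply; rewrite mem_enum.
Qed.

Lemma key_inj : injective key.
Proof. by move=> v w [_ /values_inj]. Qed.

(** The coordinatewise order is contained in the order on the nodes; this compares
    the corners of a square. *)
Lemma key_le v w : (forall i, v i <= w i)%N -> (key v <= key w)%O.
Proof.
move=> vw; rewrite /key Order.SeqLexiOrder.Exports.lexi_cons leEnat.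
rewrite /pdepth sub_count /=; last first.
  by move=> i; rewrite -!lt0n => /leq_trans; apply.
apply/implyP => _; elim: (enum 'I_m) => // i s IHs.
rewrite /values /= Order.SeqLexiOrder.Exports.lexi_cons leEnat vw.
by apply/implyP.
Qed.

Lemma key_lt v w : (forall i, v i <= w i)%N -> v <> w -> (key v < key w)%O.
Proof.
move=> vw ne; rewrite lt_neqAle key_le // andbT.
by apply/eqP => /key_inj.
Qed.

Lemma edge_sym p v w : edge p v w -> edge p w v.
Proof. by move=> e i; rewrite eq_sym e. Qed.

Lemma edge_neq p v w : edge p v w -> v <> w.
Proof. by move=> e vw; have := e p; rewrite vw !eqxx. Qed.

Lemma edge_off p v w i : edge p v w -> i != p -> v i = w i.
Proof. by move=> e ip; apply/eqP; rewrite e. Qed.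

Lemma edge_key p v w : edge p v w -> (key v < key w)%O = (v p < w p)%N.
Proof.
have H v' w' : edge p v' w' -> (v' p < w' p)%N -> (key v' < key w')%O.
  move=> e lt; apply: key_lt (edge_neq e) => i.
  by have [->|ip] := eqVneq i p; [exact: ltnW|rewrite (edge_off e ip)].
move=> e; apply/idP/idP; last exact: H.
move=> vw; have := e p; rewrite eqxx /= => /negbT ne.
rewrite ltn_neqAle -(inj_eq val_inj) in ne *; rewrite ne /= leqNgt.
by apply/negP => /(H _ _ (edge_sym e)) /(lt_trans vw); rewrite ltxx.
Qed.

Lemma result_edge_color v w p : result (edge_color v w) = Some p <-> edge p v w.
Proof.
rewrite /edge_color result_bind result_filterM.
rewrite (eq_filter (a2 := fun i => v i != w i)); last first.
  by move=> i; rewrite !resE -(inj_eq val_inj).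
have mem i : (i \in [seq j <- enum 'I_m | v j != w j]) = (v i != w i).
  by rewrite mem_filter mem_enum andbT.
split.
  case E : [seq j <- enum 'I_m | v j != w j] => [//|p' [|//]] [pp] i.
  by apply: negb_inj; rewrite -mem E inE pp negbK.
move=> e; have uf : uniq [seq j <- enum 'I_m | v j != w j].
  by rewrite filter_uniq ?enum_uniq.
have H : [seq j <- enum 'I_m | v j != w j] =i [:: p].
  by move=> i; rewrite mem e inE negbK.
by rewrite (perm_small_eq _ (uniq_perm uf _ H)).

Qed.

Lemma result_next_node v :
  match result (next_node v) with
  | Some w => (key v < key w)%O /\ forall z, (key v < key z)%O -> (key w <= key z)%O
  | None => forall z, (key z <= key v)%O
  end.
Proof.
rewrite /next_node result_foldM.
set f := (X in foldl X).
suff H s : match foldl f None s with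
  | Some w => (key v < key w)%O /\
      {in s, forall z, (key v < key z)%O -> (key w <= key z)%O}
  | None => {in s, forall z, (key z <= key v)%O}
  end.
  case: (foldl f None _) (H (enum {: node})) => [w [vw wm]|vm].
    by split=> // z; apply: wm; rewrite mem_enum.
  by move=> z; apply: vm; rewrite mem_enum.
elim/last_ind: s => [//|s w]; rewrite foldl_rcons.
have -> best : f best w = if (key v < key w)%O then
    if best is Some z then if (key w < key z)%O then Some w else best else Some w
    else best.
  rewrite /f -!result_prec result_bind; case: (result (prec v w)) => //.
  by case: best => // z; rewrite -result_prec result_bind; case: (result (prec w z)).

case: (foldl f None s) => [b [vb bm]|vm].
  case: ltP => vw; last first.
    split=> // z; rewrite mem_rcons inE => /predU1P[->|]; last exact: bm.
    by move=> vw'; have := lt_le_trans vw' vw; rewrite ltxx.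
  case: ltP => wb; (split=> // z; rewrite mem_rcons inE => /predU1P[->//|]).
    by move=> /bm H /H; apply: le_trans; apply: ltW.
  exact: bm.

case: ltP => vw.
  split=> // z;
 rewrite mem_rcons inE => /predU1P[->//|/vm zv vz].

  by have := le_lt_trans zv vz; rewrite ltxx.
by move=> z; rewrite mem_rcons inE => /predU1P[->//|/vm].
Qed.

Lemma key_first (J_gt0 : forall i, (0 < J i)%N) w :
  (key (first_node J_gt0) <= key w)%O.
Proof. by apply: key_le => i; rewrite ffunE. Qed.

End NodeOrder.

(** * The search *)

Section Search.
Variables (m n : nat) (J : 'I_m -> nat).
Notation node := {dffun forall i, 'I_(J i)}.
Notation assignment := {ffun node -> nat}.
Variables (rels : seq (seq 'rV['F_2]_m)) (D : seq (seq {ffun 'I_m -> bool})).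
Implicit Types (u v w nu mu : node) (pi : assignment) (prev : seq node).

Definition corner_node q nu mu : node := [ffun i => if i == q then mu i else nu i].

(** The tests passed by the value [k] at [v]; [corner_node q nu mu] completes the
    square with corners [nu], [mu] and [v]. *)
Definition compatible pi prev v k : Prop :=
  forall nu p, nu \in prev -> edge p nu v ->
    result (in_component D p (pi nu) k) /\
    forall mu q, mu \in prev -> edge q mu v -> (key nu < key mu)%O -> q != p ->
      result (missing_piece rels p q (pi (corner_node q nu mu)) (pi mu) (pi nu))
        = Some k.

Lemma foldl_filter (A B : eqType) (c : A -> pred B) (g : seq B -> A -> seq B) s La :
  (forall La' x, g La' x = [seq k <- La' | c x k]) ->
  foldl g La s = [seq k <- La | all (fun x => c x k) s].
Proof.
move=> gE; elim: s La => [|x s IHs] La /=; first by rewrite filter_predT.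
by rewrite gE IHs -filter_predI; apply: eq_filter => k /=; rewrite andbC.
Qed.

Lemma candidatesP pi prev v :
  uniq (result (candidates rels D pi prev v)) /\
  forall k, k \in result (candidates rels D pi prev v) <->
    (k < size rels)%N /\ compatible pi prev v k.
Proof.
pose c2 p nu mu (k : nat) : bool :=
  if result (edge_color mu v) is Some q then
    ((key nu < key mu)%O && (q != p)) ==>
    (result (missing_piece rels p q (pi (corner_node q nu mu)) (pi mu) (pi nu)) == Some k)
  else true.
pose c1 nu (k : nat) : bool :=
  if result (edge_color nu v) is Some p then
    result (in_component D p (pi nu) k) && all (fun mu => c2 p nu mu k) prev
  else true.
have -> : result (candidates rels D pi prev v) =
    [seq k <- iota 0 (size rels) | all (fun nu => c1 nu k) prev].
  rewrite /candidates result_foldM; apply: foldl_filter => La nu.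
  rewrite result_bind /c1; case: (result (edge_color nu v)) => [p|]; last first.
    by rewrite filter_predT.
  rewrite !result_bind result_foldM result_filterM.
  rewrite (foldl_filter (c := c2 p nu)); last first.
    move=> La' mu; rewrite result_bind /c2.
    case: (result (edge_color mu v)) => [q|]; last by rewrite filter_predT.
    rewrite result_bind result_prec; case: (_ && _) => /=; last by rewrite filter_predT.
    by rewrite !result_bind result_filterM.
  by rewrite -filter_predI; apply: eq_filter => k /=; rewrite andbC.
split; first by rewrite filter_uniq ?iota_uniq.
move=> k; rewrite mem_filter mem_iota add0n /= andbC.
split.
  case/andP => -> /allP H; split=> // nu p nup /result_edge_color e.
  have := H nu nup; rewrite /c1 e => /andP[-> /allP H']; split=> // mu q mup.
  move=> /result_edge_color e' lt qp; have := H' mu mup.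
  by rewrite /c2 e' lt qp => /eqP.
case=> -> H; apply/allP => nu nup; rewrite /c1.
case E : (result _) => [p|//]; move/result_edge_color: E => E.
have [-> H'] := H nu p nup E; apply/allP => mu mup; rewrite /c2.
case E' : (result _) => [q|//]; move/result_edge_color: E' => E'.
by apply/implyP => /andP[lt qp]; rewrite (H' mu q).
Qed.

(** The same tests for a total assignment, where the preceding nodes are given by
    the order instead of a list. *)
Definition admissible pi v : Prop :=
  (pi v < size rels)%N /\
  forall nu p, (key nu < key v)%O -> edge p nu v ->
    result (in_component D p (pi nu) (pi v)) /\
    forall mu q, (key mu < key v)%O -> edge q mu v -> (key nu < key mu)%O ->
      q != p ->
      result (missing_piece rels p q (pi (corner_node q nu mu)) (pi mu) (pi nu))
        = Some (pi v).

Lemma corner_node_lt p q nu mu v : p != q -> edge p nu v -> edge q mu v ->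
  (key nu < key v)%O -> (key mu < key v)%O -> (key (corner_node q nu mu) < key v)%O.
Proof.
move=> pq ep eq; rewrite (edge_key ep) (edge_key eq) => ltp ltq.
apply: key_lt => [i|e].
  rewrite ffunE; case: (eqVneq i q) => [->|iq]; first exact: ltnW.
  have [->|ip] := eqVneq i p; first exact: ltnW.
  by rewrite (edge_off ep ip).
have := congr1 (fun f : node => f q) e; rewrite ffunE eqxx => e'.
by move: ltq; rewrite e' ltnn.
Qed.

(** The tests at [v] read only values at nodes that precede [v]: this holds for the
    fourth corner by [corner_node_lt]. *)
Lemma compatible_admissible pi pi' prev v :
  (forall w, (w \in prev) = (key w < key v)%O) ->
  {in prev, forall w, pi' w = pi w} ->
  ((pi' v < size rels)%N /\ compatible pi prev v (pi' v)) <-> admissible pi' v.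
Proof.
move=> prevE agree.
have agree' w : (key w < key v)%O -> pi' w = pi w by rewrite -prevE; apply: agree.
split=> -[lt_size H]; split=> // nu p.

  move=> lt e; rewrite (agree' nu) //; have [|->
 H'] := H nu p _ e; first by rewrite prevE.
  split=> // mu q lt' e' nm qp.
  rewrite (agree' mu) // (agree' (corner_node q nu mu)).
    by apply: H' => //; rewrite prevE.
  by apply: corner_node_lt e e' lt lt'; rewrite eq_sym.
rewrite prevE => lt e; have [] := H nu p lt e; rewrite (agree' nu) // => -> H'.
split=> // mu q; rewrite prevE => lt' e' nm qp.
rewrite -(agree' mu) // -(agree' (corner_node q nu mu)); first exact: H'.
by apply: corner_node_lt e e' lt lt'; rewrite eq_sym.
Qed.

Lemma uniq_flatten_tag (A B : eqType) (g : A -> seq B) (h : B -> A) s :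
  uniq s -> (forall k, uniq (g k)) -> (forall k, {in g k, forall x, h x = k}) ->
  uniq (flatten [seq g k | k <- s]).
Proof.
move=> us ug hg; elim: s us => //= k s IHs /andP[ks us].
rewrite cat_uniq ug IHs // andbT; apply/hasPn => x /flatten_mapP[k' k's xk'].
by apply: contra ks => /hg <-; rewrite (hg _ _ xk').
Qed.

(** The list [prev] always is an initial segment of the order, because [next_node]
    returns the successor; and the fuel bounds the number of nodes left. *)
Lemma procedureP fuel pi prev ov :
  match ov with
  | Some v => forall w, (w \in prev) = (key w < key v)%O
  | None => forall w, w \in prev
  end -> uniq prev -> (#|{: node}| <= size prev + fuel)%N ->
  uniq (result (procedure rels D fuel pi prev ov)) /\
  forall pi', pi' \in result (procedure rels D fuel pi prev ov) <->
    {in prev, forall w, pi' w = pi w} /\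
    (forall w, w \notin prev -> admissible pi' w).
Proof.
elim: fuel pi prev ov => [|fuel IHf] pi prev [v|] prevE uprev size_fuel; last 1 first.
- rewrite /=; split=> // pi'; rewrite inE; split=> [/eqP -> //|[H _]].
    by split=> // w; rewrite prevE.
  by apply/eqP/ffunP => w; apply: H.
- have := prevE v; rewrite ltxx => /negP; case.
  have c : #|prev| = #|{: node}|.
    apply/eqP; rewrite eqn_leq max_card /= (card_uniqP uprev).
    by rewrite addn0 in size_fuel.
  by rewrite (subset_cardP c (subset_predT _) v).

- rewrite /=; split=> // pi'; rewrite inE; split=> [/eqP -> //|[H _]].
    by split=> // w; rewrite prevE.
  by apply/eqP/ffunP => w; apply: H.
rewrite /= result_bind result_foldM.
have [uc cP] := candidatesP pi prev v.
set La := result _ in uc cP *.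
pose pi_ k : assignment := [ffun w => if w == v then k else pi w].
pose g k := result (procedure rels D fuel (pi_ k) (rcons prev v) (result (next_node v))).
have -> : foldl (fun out k => result
    (let! pi' := pset pi v k in
     let! ov' := next_node v in
     let! out' := procedure rels D fuel pi' (rcons prev v) ov' in
     ret (out ++ out'))) [::] La = flatten [seq g k | k <- La].
  rewrite -[RHS]cat0s; elim: La [::] {uc cP} => [|k s IHs] out /=.
    by rewrite cats0.
  by rewrite IHs !result_bind result_ret catA.
have vprev : v \notin prev by rewrite prevE ltxx.
have uprev' : uniq (rcons prev v) by rewrite rcons_uniq vprev.
have IH k := IHf (pi_ k) (rcons prev v) (result (next_node v)).
have {}IH k : uniq (g k) /\ forall pi', pi' \in g k <->
    {in rcons prev v, forall w, pi' w = pi_ k w} /\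
    (forall w, w \notin rcons prev v -> admissible pi' w).
  apply: IH => //; last by rewrite size_rcons addSnnS.
  case: (result _) (result_next_node v) => [v' [vv' v'm]|vm] w;
    rewrite mem_rcons inE prevE.
    apply/predU1P/idP => [[->//|wv]|wv']; first exact: lt_trans vv'.
    have [wv|vw|/key_inj ->] := ltgtP (key w) (key v); [by right| |by left].
    by have := lt_le_trans wv' (v'm _ vw); rewrite ltxx.
  by have := vm w; rewrite le_eqVlt => /orP[/eqP/key_inj ->|->]; rewrite ?eqxx ?orbT.
have vr : v \in rcons prev v by rewrite mem_rcons mem_head.
split.
  apply: (@uniq_flatten_tag _ _ _ (fun pi' : assignment => pi' v)) => // k.
    by case: (IH k).
  move=> pi' /(proj2 (IH k) pi')[agree _].
  by rewrite agree // ffunE eqxx.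
move=> pi'; split.
  case/flatten_mapP => k kLa /(proj2 (IH k) pi')[agree adm].
  have agree' : {in prev, forall w, pi' w = pi w}.
    move=> w wp; rewrite agree ?mem_rcons ?inE ?wp ?orbT // ffunE.
    by case: eqP => // wv; rewrite -wv wp in vprev.
  split=> // w wp; have [->|wv] := eqVneq w v.
    apply/(compatible_admissible prevE agree'); apply/cP.
    by rewrite agree // ffunE eqxx.
  by apply: adm; rewrite mem_rcons inE negb_or wv.
case=> agree adm; apply/flatten_mapP; exists (pi' v).
  by apply/cP/(compatible_admissible prevE agree); apply: adm.
apply/(proj2 (IH _) pi'); split.
  move=> w; rewrite mem_rcons inE ffunE; case: eqP => [-> //|_] /=; exact: agree.
by move=> w; rewrite mem_rcons inE negb_or => /andP[_]; apply: adm.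
Qed.

Lemma procedure_all (J_gt0 : forall i, (0 < J i)%N) pi0 :
  let out := result (procedure rels D #|{: node}| pi0 [::] (Some (first_node J_gt0))) in
  uniq out /\ forall pi, pi \in out <-> forall w, admissible pi w.
Proof.
have [|//|//|u H] := @procedureP #|{: node}| pi0 [::] (Some (first_node J_gt0)).
  by move=> w; rewrite in_nil ltNge key_first.
split=> // pi; rewrite H; split=> [[_ H'] w|H']; first exact: H'.

by split.
Qed.

End Search.

(** * Correctness of the search *)

(** The scan of the classes returns the last match, hence the only one. *)
Lemma foldl_unique (P : pred nat) s k :
  {in s &, forall i j, P i -> P j -> i = j} ->
  foldl (fun found i => if P i then Some i else found) None s = Some k <->
  (k \in s) && P k.
Proof.
elim/last_ind: s => [|s i IHs] uP; first by [].
have sub j : j \in s -> j \in rcons s i by rewrite mem_rcons inE orbC => ->.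
rewrite foldl_rcons mem_rcons inE; case: (boolP (P i)) => Pi.
  split=> [[<-]|/andP[/predU1P[-> //|ks] Pk]]; first by rewrite eqxx.
  by rewrite (uP k i (sub _ ks) _ Pk Pi) // mem_rcons mem_head.
rewrite IHs; last by move=> a b /sub ? /sub; apply: uP.
by case: (eqVneq k i) => [->|//]; rewrite (negPf Pi) !andbF.
Qed.

Section Correctness.
Variables (m n : nat) (L : {set {set 'I_m}}) (J : 'I_m -> nat).
Variable cm : seq (cmap 'I_m n).
Hypotheses (sL : simplicial_complex L) (cmE : represents_CM L cm).
Notation node := {dffun forall i, 'I_(J i)}.
Notation assignment := {ffun node -> nat}.
Implicit Types (p q : 'I_m) (pi : assignment) (u v w mu nu : node).

Let rels := result (mapM (@relations m n) cm).
Let D := result (prediagram rels).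
Let cl k := nth [ffun=> 0] cm k.

Lemma size_rels : size rels = size cm.
Proof. by rewrite /rels result_mapM size_map. Qed.

Lemma mem_cm_char_map l : l \in cm -> char_map L l.
Proof.
move=> lcm; have : DJ l \in CM n L by rewrite -(proj2 cmE) map_f.
case/imsetP => l'; rewrite inE => Ll' /DJ_eqP E.
apply/(char_mapP _ sL) => r rL; rewrite E.
exact: (proj1 (char_mapP _ sL) Ll').
Qed.

Lemma cl_char_map k : (k < size cm)%N -> char_map L (cl k).
Proof. by move=> lt; apply/mem_cm_char_map/mem_nth. Qed.

Lemma cl_neq0 k p : (k < size cm)%N -> cl k p != 0.
Proof. by move=> /cl_char_map Kk; apply: char_map_neq0 sL Kk. Qed.

Lemma DJ_cl k : (k < size cm)%N -> nth set0 [seq DJ l | l <- cm] k = DJ (cl k).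
Proof. by move=> lt; rewrite (nth_map [ffun=> 0]). Qed.

Lemma cl_inj k k' : (k < size cm)%N -> (k' < size cm)%N ->
  is_relation (cl k) =1 is_relation (cl k') -> k = k'.
Proof.
move=> lt lt' /DJ_eqP; rewrite -!DJ_cl // => /eqP.
by rewrite nth_uniq ?size_map ?(proj1 cmE) // => /eqP.
Qed.

Lemma spans_cl k : (k < size cm)%N -> spans_relations (nth [::] rels k) (cl k).
Proof.
move=> lt; rewrite /rels result_mapM (nth_map [ffun=> 0]) //; exact: relationsP.
Qed.

Lemma in_componentP p a b : (a < size cm)%N -> (b < size cm)%N ->
  result (in_component D p a b) <-> slides p (cl a) (cl b) /\ slides p (cl b) (cl a).
Proof.
move=> lta ltb; rewrite -(adjacent_testP p (spans_cl lta) (spans_cl ltb)).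
have DE : D = [seq [seq [ffun p' => result (adjacent_test p' C1 C2)] | C2 <- rels]
    | C1 <- rels].
  by rewrite [LHS]result_mapM; apply: eq_map => C1; rewrite [LHS]result_mapM.
rewrite /in_component !result_bind !result_op DE.
rewrite (nth_map [::]) ?size_rels // (nth_map [::]) ?size_rels //.
by rewrite ffunE.

Qed.

(** At most one class passes the test since distinct classes have distinct spaces
    of relations. *)
Lemma missing_pieceP p q c a b k : (c < size cm)%N -> (a < size cm)%N ->
  (b < size cm)%N -> (k < size cm)%N ->
  slides p (cl c) (cl a) -> slides p (cl a) (cl c) ->
  slides q (cl c) (cl b) -> slides q (cl b) (cl c) ->
  result (missing_piece rels p q c a b) = Some k <->
  square p q (cl c) (cl a) (cl b) (cl k).
Proof.
move=> ltc lta ltb ltk ca ac cb bc.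
rewrite -(missing_relationsP (spans_cl ltc) (spans_cl lta) (spans_cl ltb)
  (spans_cl ltk)) ?cl_neq0 //.
pose G := result (missing_relations p q (nth [::] rels c) (nth [::] rels a) (nth [::] rels b)).
pose P i := result (same_span G (nth [::] rels i)).
have -> : result (missing_piece rels p q c a b) =
    foldl (fun found i => if P i then Some i else found) None (iota 0 (size rels)).
  by rewrite /missing_piece 4!result_bind result_foldM.
rewrite foldl_unique
; first by rewrite mem_iota add0n size_rels ltk.
move=> i j; rewrite !mem_iota !add0n !size_rels /= => lti ltj.
rewrite /P !result_same_span => /eqP Gi /eqP Gj; apply: cl_inj => // r.
have := spans_cl lti (row_of r); have := spans_cl ltj (row_of r).
by rewrite -Gi -Gj row_ofE => -> ->.
Qed.

Lemma adjacent_cl p a b : (a < size cm)%N -> (b < size cm)%N ->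
  adjacent L p (DJ (cl a)) (DJ (cl b)) <->
  slides p (cl a) (cl b) /\ slides p (cl b) (cl a).
Proof. by move=> lta ltb; apply: adjacentP => //; apply: cl_char_map. Qed.

Lemma realizable_square_cl p q a b c d : p != q -> (a < size cm)%N ->
  (b < size cm)%N -> (c < size cm)%N -> (d < size cm)%N ->
  realizable_square L p q (DJ (cl a)) (DJ (cl b)) (DJ (cl c)) (DJ (cl d)) <->
  square p q (cl a) (cl b) (cl c) (cl d).
Proof. by move=> pq *; apply: realizable_squareP => //; apply: cl_char_map. Qed.

Lemma corner_node_square p q u mu nu v : p != q ->
  edge p u mu -> edge p nu v -> edge q u nu -> edge q mu v ->
  u = corner_node q nu mu.
Proof.
move=> pq epu epv equ eqv; apply/ffunP => i; rewrite ffunE.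
case: (eqVneq i q) => [->|iq]; last exact: edge_off equ iq.
by apply: edge_off epu _; rewrite eq_sym.
Qed.

Lemma corner_node_edges p q mu nu v : p != q -> edge p nu v -> edge q mu v ->
  edge p (corner_node q nu mu) mu /\ edge q (corner_node q nu mu) nu.
Proof.
move=> pq ep eq; split=> i; rewrite ffunE.
  case: (eqVneq i q) => [->|iq]; first by rewrite eqxx eq_sym pq.
  by rewrite (edge_off eq iq) ep.
case: (eqVneq i q) => [->|iq]; last by rewrite eqxx.
have qp : q != p by rewrite eq_sym.
by rewrite (edge_off ep qp) eq eqxx.

Qed.

(** The algorithm tests each square in one orientation only, with its largest
    corner [v] opposite to [u] and with [nu] preceding [mu]. The other seven follow
    by the symmetries of [square]. *)
Lemma admissible_puzzle pi :
  (forall w, admissible rels D pi w) <->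
  (forall w, (pi w < size cm)%N) /\ realizable_puzzle L (puzzle_of cm pi).
Proof.
split=> [adm|[lt [_ edges squares]] v].
  have lt w : (pi w < size cm)%N by have [] := adm w; rewrite size_rels.
  have pE w : puzzle_of cm pi w = DJ (cl (pi w)) by rewrite ffunE DJ_cl.
  have adj p v w : edge p v w ->
      slides p (cl (pi v)) (cl (pi w)) /\ slides p (cl (pi w)) (cl (pi v)).
    move=> e; have [lt1|lt2|/key_inj ew] := ltgtP (key v) (key w).
    - by apply/(in_componentP p (lt v) (lt w)); have [_ /(_ v p lt1 e)[]] := adm w.
    - have [_ /(_ w p lt2 (edge_sym e))[H _]] := adm v.
      by move/(in_componentP p (lt w) (lt v)): H => [].
    - by case: (edge_neq e).
  split=> //; split.
  - move=> v; rewrite pE;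
 have := proj2 cmE (DJ (cl (pi v))) => <-.
    exact/map_f/mem_nth.
  - by move=> p v w e; rewrite !pE; apply/adjacent_cl => //; apply: adj.
  move=> p q u mu nu v pq epu epv equ eqv; rewrite !pE; apply/realizable_square_cl => //.
  (* The orientation tested at v'. *)
  have sorted p' q' u' mu' nu' v' : p' != q' ->
      edge p' u' mu' -> edge p' nu' v' -> edge q' u' nu' -> edge q' mu' v' ->
      (u' p' < mu' p')%N -> (u' q' < nu' q')%N -> (key nu' < key mu')%O ->
      square p' q' (cl (pi u')) (cl (pi mu')) (cl (pi nu')) (cl (pi v')).
    move=> pq' e1 e2 e3 e4 lt1 lt2 nm.
    have qp' : q' != p' by rewrite eq_sym.
    have ltnu : (key nu' < key v')%O.
      by rewrite (edge_key e2) -(edge_off e3 pq') -(edge_off e4 pq').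
    have ltmu : (key mu' < key v')%O.
      by rewrite (edge_key e4) -(edge_off e1 qp') -(edge_off e2 qp').
    have [_ /(_ nu' p' ltnu e2)[_ /(_ mu' q' ltmu e4 nm qp')]] := adm v'.
    rewrite -(corner_node_square pq' e1 e2 e3 e4).
    have [a1 a2] := adj _ _ _ e1; have [a3 a4] := adj _ _ _ e3.
    by move/missing_pieceP; apply.
  (* Exchanging the two colors exchanges nu' and mu'. *)
  have oriented u' mu' nu' v' :
      edge p u' mu' -> edge p nu' v' -> edge q u' nu' -> edge q mu' v' ->
      (u' p < mu' p)%N -> (u' q < nu' q)%N ->
      square p q (cl (pi u')) (cl (pi mu')) (cl (pi nu')) (cl (pi v')).
    move=> e1 e2 e3 e4 lt1 lt2.
    have [nm|mn|/key_inj e] := ltgtP (key nu') (key mu').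
    - exact: sorted.
    - by apply: square_swap; apply: sorted; rewrite // eq_sym.
    - by rewrite (edge_off e3 pq) e ltnn in lt1.

  have edge_ltgt p' v' w' : edge p' v' w' -> (v' p' < w' p')%N \/ (w' p' < v' p')%N.
    move=> e; have := e p'; rewrite eqxx -(inj_eq val_inj) /= => /negbT.
    by rewrite neq_ltn => /orP.
  have qp : q != p by rewrite eq_sym.
  (* Flipping along p or q moves the corner with the smaller coordinates to u. *)
  have [lt1|lt1] := edge_ltgt _ _ _ epu; have [lt2|lt2] := edge_ltgt _ _ _ equ.
  - exact: oriented.
  - apply/square_swap/square_flip/square_swap.
    apply: oriented; rewrite // 1?edge_sym //; try exact: edge_sym.
    by rewrite -(edge_off equ pq) -(edge_off eqv pq).
  - apply/square_flip; apply: oriented => //; try exact: edge_sym.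
    by rewrite -(edge_off epu qp) -(edge_off epv qp).
  - apply/square_flip/square_swap/square_flip/square_swap.
    apply: oriented => //; try exact: edge_sym.
      by rewrite -(edge_off equ pq) -(edge_off eqv pq).
    by rewrite -(edge_off epu qp) -(edge_off epv qp).
have pE w : puzzle_of cm pi w = DJ (cl (pi w)) by rewrite ffunE DJ_cl.
have adj p u w : edge p u w ->
    slides p (cl (pi u)) (cl (pi w)) /\ slides p (cl (pi w)) (cl (pi u)).
  by move=> e; apply/adjacent_cl => //; rewrite -!pE; apply: edges.
split; first by rewrite size_rels.
move=> nu p ltnu ep; split; first by apply/in_componentP => //; apply: adj.
move=> mu q ltmu eq nm qp.
have pq : p != q by rewrite eq_sym.
have [e1 e3] := corner_node_edges pq ep eq.
have [a1 a2] := adj _ _ _ e1; have [a3 a4] := adj _ _ _ e3.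
apply/missing_pieceP => //; apply/realizable_square_cl => //; rewrite -!pE.
exact: squares.
Qed.

Lemma puzzle_of_inj pi pi' : (forall w, (pi w < size cm)%N) ->
  (forall w, (pi' w < size cm)%N) -> puzzle_of cm pi = puzzle_of cm pi' -> pi = pi'.
Proof.
move=> lt lt' e; apply/ffunP => w.
have := congr1 (fun f : {ffun node -> _} => f w) e; rewrite !ffunE => /eqP.
by rewrite nth_uniq ?size_map ?(proj1 cmE) // => /eqP.
Qed.

Lemma algorithm_correct (J_gt0 : forall i, (0 < J i)%N) :
  let out := [seq puzzle_of cm pi | pi <- result (new_puzzle_algorithm cm J_gt0)] in
  uniq out /\ forall P, P \in out <-> realizable_puzzle L P.
Proof.
have [u H] := procedure_all rels D J_gt0 [ffun=> 0%N].
have {}H pi : pi \in result (new_puzzle_algorithm cm J_gt0) <->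
    (forall w, (pi w < size cm)%N) /\ realizable_puzzle L (puzzle_of cm pi).
  by rewrite -admissible_puzzle -H.
split.
  rewrite map_inj_in_uniq // => pi pi' /H[lt _] /H[lt' _].
  exact: puzzle_of_inj.
move=> P; split=> [/mapP[pi /H[_ r] ->] //|rP].
have [CMP _ _] := rP.
pose pi : assignment := [ffun v => index (P v) [seq DJ l | l <- cm]].
have mem v : P v \in [seq DJ l | l <- cm] by rewrite (proj2 cmE).
have PE : P = puzzle_of cm pi.
  by apply/ffunP => v; rewrite !ffunE nth_index.
rewrite PE map_f //; apply/H; rewrite -PE; split=> // w.
by rewrite ffunE -(size_map (@DJ _ _) cm) index_mem.
Qed.

End Correctness.

(** * The cost bound *)

(** The cost as a function of the input without the proof that [J] is positive, so
    that a maximum over inputs makes sense. *)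
Definition cost_of m n (cm : seq (cmap 'I_m n)) (J : 'I_m -> nat) : nat :=
  if pselect (forall i, 0 < J i)%N is left J_gt0
  then cost (new_puzzle_algorithm cm J_gt0) else 0%N.

Lemma cost_ofE m n (cm : seq (cmap 'I_m n)) (J : 'I_m -> nat)
  (J_gt0 : forall i, (0 < J i)%N) :
  cost (new_puzzle_algorithm cm J_gt0) = cost_of cm J.
Proof.
rewrite /cost_of; case: pselect => // J_gt0'.
by rewrite (Prop_irrelevance J_gt0 J_gt0').
Qed.

(** The bounds on [m], [n] and the entries of [J] leave finitely many inputs. *)
Definition worst_cost (c len pic : nat) : nat :=
  let M := (2 * 2 ^ pic)%N in
  (\max_(m < M.+1) \max_(n < M.+1) \max_(J : {ffun 'I_m -> 'I_len.+2})
     \max_(cm : c.-tuple (cmap 'I_m n)) cost_of cm (fun i => J i))%N.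

(** Without classes the search stops at once; this covers complexes without
    characteristic maps, to which [seed_bound] does not apply. *)
Lemma cost_nil m n (J : 'I_m -> nat) (J_gt0 : forall i, (0 < J i)%N) :
  cost (new_puzzle_algorithm ([::] : seq (cmap 'I_m n)) J_gt0) = 0%N.
Proof. by rewrite /new_puzzle_algorithm /=; case: #|_|. Qed.

Lemma len_bound m (J : 'I_m -> nat) i : (forall i, 0 < J i)%N ->
  (J i < (len J).+2)%N.
Proof.
move=> J0; rewrite ltnS /len (bigD1 i) //=.
have : (m.-1 <= \sum_(j | j != i) J j)%N.
  have <- : \sum_(j < m | j != i) 1 = m.-1.
    by rewrite sum1_card (cardC1 i) card_ord.
  by apply: leq_sum => j _.
have : (0 < m)%N by apply: leq_ltn_trans (ltn_ord i).
case: m J i J0 => // m J i J0 _ /= le.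
move: (\sum_(_ < _ | _) _)%N le => S le.
by rewrite subnSK ?(leq_add (J0 i) le) // -addnBA // leq_addr.

Qed.

Lemma cost_bound m n (cm : seq (cmap 'I_m n)) (J : 'I_m -> nat)
    (J_gt0 : forall i, (0 < J i)%N) :
  (m <= 2 * 2 ^ (m - n))%N -> (n <= m)%N ->
  (cost (new_puzzle_algorithm cm J_gt0) <= worst_cost (size cm) (len J) (m - n))%N.
Proof.
move=> mM nm; rewrite cost_ofE /worst_cost.
set M := (2 * _)%N.
have mM' : (m < M.+1)%N by [].
have nM' : (n < M.+1)%N by rewrite ltnS (leq_trans nm).
pose Jf : {ffun 'I_m -> 'I_(len J).+2} := [ffun i => Ordinal (len_bound i J_gt0)].
apply: leq_trans (leq_bigmax (Ordinal mM')) => /=.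
apply: leq_trans (leq_bigmax (Ordinal nM')) => /=.
apply: leq_trans (leq_bigmax Jf) => /=.
apply: leq_trans (leq_bigmax (in_tuple cm)) => /=.
by rewrite (_ : (fun i => _) = J) //; apply/funext => i; rewrite ffunE.
Qed.

Local Close Scope ring_scope.

Theorem theorem4p8 (R : realType) :
  exists f : nat -> nat -> nat -> nat,
  forall (m n : nat) (L : {set {set 'I_m}}) (J : 'I_m -> nat)
         (J_gt0 : forall i, 0 < J i) (cm : seq (cmap 'I_m n)),
    simplicial_complex L -> pure L n -> PL_sphere R L n -> seed L ->
    represents_CM L cm ->
    let run := new_puzzle_algorithm cm J_gt0 in
    let out := [seq puzzle_of cm pi | pi <- result run] in
    [/\ uniq out,
        forall pi : {ffun node J -> {set cmap 'I_m n}},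
          pi \in out <-> realizable_puzzle L pi &
        cost run <= f #|CM n L| (len J) (m - n)].
Proof.
exists worst_cost => m n L J J_gt0 cm sL pL spL seedL cmE run out.
have [u H] := algorithm_correct sL cmE J_gt0.
split=> //; rewrite /run.
have -> : #|CM n L| = size cm.
  rewrite -(size_map (@DJ _ _)) -(card_uniqP (proj1 cmE)).
  exact/esym/eq_card/(proj2 cmE).
case: cm cmE {run out u H} => [|l cm] cmE; first by rewrite cost_nil.
have Ll : char_map L l by apply: (mem_cm_char_map sL cmE); rewrite mem_head.
apply: cost_bound.
  by have := seed_bound sL pL spL Ll seedL; rewrite card_ord.
have [|F fF _] := @face_in_facet _ L set0; first by case: sL.
by rewrite -(pL F fF) -[X in (_ <= X)%N]card_ord max_card.
Qed.
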